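(* Let $(V,\partial_V,\mu_2,\mu_3,\dots)$ be an $A_\infty$ algebra, let $(W,\partial_W)$ be a chain complex, let $f:V\to W$ and $g:W\to V$ be chain maps, and let $h:V\to V$ be a linear map of degree $1$ with $gf-\mathrm{id}_V=\partial_V h+h\partial_V$. Define maps $p_n:V^{\otimes n}\to V$ ($n\ge 2$) inductively by $$p_n=\sum_{B(n)}(-1)^{\vartheta(r_1,\dots,r_k)}\mu_k\bigl(h\circ p_{r_1}\otimes\cdots\otimes h\circ p_{r_k}\bigr),$$ with the convention $h\circ p_1:=\mathrm{id}_V$. Then for all $n\ge 2$ $$\partial_V p_n-\sum_{u=1}^{n}(-1)^{n}p_n\bigl(\mathrm{id}_V^{\otimes u-1}\otimes\partial_V\otimes \mathrm{id}_V^{\otimes n-u}\bigr)-\sum_{A(n)}(-1)^{i(\ell+1)+n}p_k\bigl(\mathrm{id}_V^{\otimes i-1}\otimes gf\circ p_\ell\otimes \mathrm{id}_V^{\otimes k-i}\bigr)=0 .$$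
   Context: We work with $\mathbb Z$-graded modules over a commutative unital ring $R$ and graded $R$-linear maps; $\mathrm{id}_V$ denotes the identity of $V$. Chain complexes are $\mathbb Z$-graded with differential of degree $-1$; chain maps have degree $0$. The Koszul sign convention is used: $(a\otimes b)(c\otimes d)=(-1)^{|b||c|}ac\otimes bd$ for maps and $(a\otimes b)(x\otimes y)=(-1)^{|x||b|}a(x)\otimes b(y)$ for elements. Index sets: $A(n)$ is the set of triples $(k,\ell,i)$ of natural numbers with $k+\ell=n+1$, $k,\ell\ge 2$, $1\le i\le k$. $B(n)$ is the set of tuples $(k,r_1,\dots,r_k)$ with $k\ge 2$, $r_1,\dots,r_k\ge 1$, $r_1+\cdots+r_k=n$. Also $\vartheta(u_1,\dots,u_k)=\sum_{1\le i<j\le k}u_i(u_j+1)$. An $A_\infty$ algebra $(V,\partial_V,\mu_2,\mu_3,\dots)$ is a chain complex $(V,\partial_V)$ with linear maps $\mu_n:V^{\otimes n}\to V$ of degree $n-2$ ($n\ge2$) such that for all $n\ge 2$ $$\partial_V\mu_n-\sum_{i=1}^n(-1)^n\mu_n(\mathrm{id}_V^{\otimes i-1}\otimes\partial_V\otimes \mathrm{id}_V^{\otimes n-i})=\sum_{A(n)}(-1)^{i(\ell+1)+n}\mu_k(\mathrm{id}_V^{\otimes i-1}\otimes\mu_\ell\otimes \mathrm{id}_V^{\otimes k-i}).$$ *)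

(* Defs.v *)
From HB Require Import structures.
From mathcomp Require Import all_boot all_order all_algebra.
From mathcomp.classical Require Import boolp.

Set Implicit Arguments.
Unset Strict Implicit.
Unset Printing Implicit Defensive.

Import GRing.Theory.
Local Open Scope ring_scope.
Local Open Scope quotient_scope.

(** * Tensor powers *)

Section TensorPower.
Variables (R : comPzRingType) (V : lmodType R) (n : nat).

(* [v] with its [i]-th entry replaced by [x]. *)
Definition tset (v : n.-tuple V) (i : 'I_n) (x : V) : n.-tuple V :=
  [tuple if j == i then x else tnth v j | j < n].

Definition multilinear (U : lmodType R) (phi : n.-tuple V -> U) : Prop :=
  forall (v : n.-tuple V) (i : 'I_n) (a : R) (x y : V),
    phi (tset v i (a *: x + y)) = a *: phi (tset v i x) + phi (tset v i y).

(* [V^(⊗n)] is presented by generators and relations.  A list of pairs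
   [(c, v)] stands for the formal sum of the [c *: (v_1 ⊗ ... ⊗ v_n)]; [teq]
   is the least congruence containing the module axioms and multilinearity. *)
Inductive teq : seq (R * n.-tuple V) -> seq (R * n.-tuple V) -> Prop :=
| teq_refl s : teq s s
| teq_sym s t : teq s t -> teq t s
| teq_trans s t u : teq s t -> teq t u -> teq s u
| teq_cat s s' t t' : teq s s' -> teq t t' -> teq (s ++ t) (s' ++ t')
| teq_catC s t : teq (s ++ t) (t ++ s)
| teq_coef0 v : teq [:: (0, v)] [::]
| teq_coefD a b v : teq [:: (a + b, v)] [:: (a, v); (b, v)]
| teq_lin c v i a x y :
    teq [:: (c, tset v i (a *: x + y))]
        [:: (c * a, tset v i x); (c, tset v i y)].

Definition teqb (s t : seq (R * n.-tuple V)) : bool := `[< teq s t >].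

Lemma teqb_refl : reflexive teqb.
Proof. by move=> s; apply/asboolP; apply: teq_refl. Qed.

Lemma teqb_sym : symmetric teqb.
Proof. by move=> s t; apply/asboolP/asboolP; apply: teq_sym. Qed.

Lemma teqb_trans : transitive teqb.
Proof. by move=> t s u /asboolP st /asboolP tu; apply/asboolP/(teq_trans st). Qed.

Canonical teq_equiv := EquivRel teqb teqb_refl teqb_sym teqb_trans.

Definition tpow := {eq_quot teq_equiv}.

HB.instance Definition _ := Choice.on tpow.
HB.instance Definition _ := EqQuotient.on tpow.

Lemma tpi_eq s t : teq s t -> \pi_tpow s = \pi_tpow t.
Proof. by move=> st; apply/eqmodP/asboolP. Qed.

Lemma tpi_eqP s t : \pi_tpow s = \pi_tpow t -> teq s t.
Proof. by move=> /eqmodP/asboolP. Qed.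

Lemma trepr s : teq (repr (\pi_tpow s)) s.
Proof. by apply: tpi_eqP; rewrite reprK. Qed.

Definition fscale (a : R) (s : seq (R * n.-tuple V)) : seq (R * n.-tuple V) :=
  [seq (a * cv.1, cv.2) | cv <- s].

Lemma fscale_teq a s t : teq s t -> teq (fscale a s) (fscale a t).
Proof.
elim=> {s t} /=.
- by move=> s; apply: teq_refl.
- by move=> s t _; apply: teq_sym.
- by move=> s t u _ st _; apply: teq_trans.
- by move=> s s' t t' _ ss _ tt; rewrite /fscale !map_cat; apply: teq_cat.
- by move=> s t; rewrite /fscale !map_cat; apply: teq_catC.
- by move=> v; rewrite mulr0; apply: teq_coef0.
- by move=> b c v; rewrite mulrDr; apply: teq_coefD.
- by move=> c v i b x y; rewrite mulrA; apply: teq_lin.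
Qed.

Definition tzero : tpow := \pi_tpow [::].
Definition tadd (x y : tpow) : tpow := \pi_tpow (repr x ++ repr y).
Definition tscale (a : R) (x : tpow) : tpow := \pi_tpow (fscale a (repr x)).
Definition topp (x : tpow) : tpow := tscale (- 1) x.

Lemma taddE s t : tadd (\pi_tpow s) (\pi_tpow t) = \pi_tpow (s ++ t).
Proof. by apply: tpi_eq; apply: teq_cat; apply: trepr. Qed.

Lemma tscaleE a s : tscale a (\pi_tpow s) = \pi_tpow (fscale a s).
Proof. by apply: tpi_eq; apply/fscale_teq/trepr. Qed.

Lemma taddA : associative tadd.
Proof.
elim/quotW=> s; elim/quotW=> t; elim/quotW=> u.
by rewrite (taddE t u) (taddE s) (taddE s t) (taddE _ u) catA.
Qed.

Lemma taddC : commutative tadd.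
Proof.
by elim/quotW=> s; elim/quotW=> t; rewrite !taddE; apply/tpi_eq/teq_catC.
Qed.

Lemma tadd0 : left_id tzero tadd.
Proof. by elim/quotW=> s; rewrite /tzero taddE. Qed.

Lemma tscaleDl (x : tpow) (a b : R) :
  tscale (a + b) x = tadd (tscale a x) (tscale b x).
Proof.
elim/quotW: x => s; rewrite !tscaleE taddE; apply: tpi_eq.
elim: s => [|[c v] s IHs] /=; first exact: teq_refl.
apply: (@teq_trans _ ([:: (a * c, v); (b * c, v)] ++ (fscale a s ++ fscale b s))).
  rewrite -cat1s; apply: teq_cat IHs.
  by rewrite mulrDl; apply: teq_coefD.
rewrite -[_ :: _ ++ _]/([:: (a * c, v)] ++ _).
rewrite -[[:: _; _] ++ _]/([:: (a * c, v)] ++ ([:: (b * c, v)] ++ _)).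
apply: teq_cat; first exact: teq_refl.
rewrite -[_ :: fscale b s]/([:: (b * c, v)] ++ _) !catA.
by apply: teq_cat; [apply: teq_catC | apply: teq_refl].
Qed.

Lemma tscale0 x : tscale 0 x = tzero.
Proof.
elim/quotW: x => s; rewrite tscaleE; apply: tpi_eq.
elim: s => [|[c v] s IHs] /=; first exact: teq_refl.
rewrite mul0r -cat1s -[[::]]/([::] ++ [::]).
by apply: teq_cat IHs; apply: teq_coef0.
Qed.

Lemma tscale1 : left_id 1 tscale.
Proof.
elim/quotW=> s; rewrite tscaleE; congr (\pi_tpow _).
rewrite -[RHS]map_id /fscale; apply: eq_map => -[c v] /=.
by rewrite mul1r.
Qed.

Lemma taddN : left_inverse tzero topp tadd.
Proof.
by move=> x; rewrite -{2}(tscale1 x) -tscaleDl addNr tscale0.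
Qed.

HB.instance Definition _ := GRing.isZmodule.Build tpow taddA taddC tadd0 taddN.

Lemma tpow_addE (x y : tpow) : x + y = tadd x y. Proof. by []. Qed.

Lemma tscaleA a b x : tscale a (tscale b x) = tscale (a * b) x.
Proof.
elim/quotW: x => s; rewrite (tscaleE b s) !tscaleE /fscale -map_comp; congr (\pi_tpow _).
by apply: eq_map => -[c v] /=; rewrite mulrA.
Qed.

Lemma tscaleDr : right_distributive tscale +%R.
Proof.
move=> a; elim/quotW=> s; elim/quotW=> t; rewrite !tpow_addE.
rewrite (taddE s t) (tscaleE a (s ++ t)) (tscaleE a s) (tscaleE a t).
by rewrite (taddE (fscale a s)) /fscale map_cat.
Qed.

Lemma tscaleDl' x : {morph tscale^~ x : a b / a + b}.
Proof. by move=> a b; apply: tscaleDl. Qed.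

HB.instance Definition _ := GRing.Zmodule_isLmodule.Build R tpow
  tscaleA tscale1 tscaleDr tscaleDl'.

Lemma tpow_scaleE (a : R) (x : tpow) : a *: x = tscale a x. Proof. by []. Qed.

(* The pure tensor [v_1 ⊗ ... ⊗ v_n]. *)
Definition pure (v : n.-tuple V) : tpow := \pi_tpow [:: (1, v)].

Lemma pure_multilinear : multilinear pure.
Proof.
move=> v i a x y; rewrite tpow_addE tpow_scaleE.
rewrite (tscaleE a [:: (1, tset v i x)]) (taddE (fscale a _)).
rewrite /fscale /= mulr1; apply: tpi_eq.
by rewrite -[X in [:: (X, tset v i x); _]]mul1r; apply: teq_lin.
Qed.

Lemma tpi_sum s : \pi_tpow s = \sum_(cv <- s) cv.1 *: pure cv.2.
Proof.
elim: s => [|[c v] s IHs]; first by rewrite big_nil.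
rewrite big_cons -IHs /= tpow_addE tpow_scaleE.
by rewrite (tscaleE c [:: (1, v)]) (taddE (fscale c _)) /fscale /= mulr1.
Qed.

Lemma tpow_ind (P : tpow -> Prop) :
  P 0 -> (forall a v x, P x -> P (a *: pure v + x)) -> forall x, P x.
Proof.
move=> P0 PD; elim/quotW=> s; rewrite tpi_sum.
by elim: s => [|[c v] s IHs]; rewrite ?big_nil // big_cons; apply: PD.
Qed.

Section Lift.
Variables (U : lmodType R) (phi : n.-tuple V -> U).

Definition tlift_fun (x : tpow) : U :=
  \sum_(cv <- repr x) cv.1 *: phi cv.2.

Hypothesis phiM : multilinear phi.

Lemma tlift_teq s t : teq s t ->
  \sum_(cv <- s) cv.1 *: phi cv.2 = \sum_(cv <- t) cv.1 *: phi cv.2.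
Proof.
elim=> {s t} //=.
- by move=> s t u _ -> _ ->.
- by move=> s s' t t' _ ss _ tt; rewrite !big_cat /= ss tt.
- by move=> s t; rewrite !big_cat /= addrC.
- by move=> v; rewrite big_seq1 big_nil scale0r.
- by move=> a b v; rewrite !big_cons !big_nil !addr0 scalerDl.
- move=> c v i a x y; rewrite !big_cons !big_nil !addr0 /= phiM.
  by rewrite scalerDr scalerA.
Qed.

Lemma tlift_pi s : tlift_fun (\pi_tpow s) = \sum_(cv <- s) cv.1 *: phi cv.2.
Proof. exact/tlift_teq/trepr. Qed.

Lemma tlift_linear : linear tlift_fun.
Proof.
move=> a; elim/quotW=> s; elim/quotW=> t.
rewrite tpow_addE tpow_scaleE (tscaleE a s) (taddE (fscale a s) t).
rewrite !tlift_pi big_cat big_map /= scaler_sumr.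
by congr (_ + _); apply: eq_bigr => cv _; rewrite scalerA.
Qed.

(* The linear map on [V^(⊗n)] induced by a multilinear map. *)
Definition tlift : tpow -> U := let _ := phiM in tlift_fun.

HB.instance Definition _ :=
  GRing.isLinear.Build R tpow U *:%R tlift tlift_linear.

Lemma tlift_pure v : tlift (pure v) = phi v.
Proof. by rewrite /tlift /= tlift_pi big_seq1 scale1r. Qed.

End Lift.

Lemma tpow_linear_ext (U : lmodType R) (f g : {linear tpow -> U}) :
  (forall v, f (pure v) = g (pure v)) -> f =1 g.
Proof.
move=> fg; apply: tpow_ind => [|a v x IHx]; first by rewrite !linear0.
by rewrite !linearP fg IHx.
Qed.

End TensorPower.

Arguments pure {R V n} v.
Arguments tlift {R V n U phi} phiM.

(* The canonical isomorphism [V^(⊗1) -> V]. *)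
Section TensorPower1.
Variables (R : comPzRingType) (V : lmodType R).

Lemma tnth0_multilinear : multilinear (fun v : 1.-tuple V => tnth v ord0).
Proof. by move=> v i a x y; rewrite !tnth_mktuple (ord1 i). Qed.

Definition tpow1 : tpow V 1 -> V := tlift tnth0_multilinear.

HB.instance Definition _ := GRing.Linear.on tpow1.

End TensorPower1.

Arguments tpow1 {R V}.

(** * Graded modules *)

(* [V] is the internal direct sum of the submodules [grcomp i], [i : int]. *)
Record grmod (R : comPzRingType) := GrMod {
  grsort :> lmodType R;
  grcomp : int -> grsort -> Prop;
  grcomp0 : forall i, grcomp i 0;
  grcompP : forall i (a : R) x y,
    grcomp i x -> grcomp i y -> grcomp i (a *: x + y);
  grcomp_sum : forall x, exists (s : seq int) (c : int -> grsort),
    [/\ uniq s, forall i, grcomp i (c i) & x = \sum_(i <- s) c i];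
  grcomp_direct : forall (s : seq int) (c : int -> grsort),
    uniq s -> (forall i, grcomp i (c i)) -> \sum_(i <- s) c i = 0 ->
    forall i, i \in s -> c i = 0
}.

Section Koszul.
Variables (R : comPzRingType) (V : grmod R).

Lemma grcomp_sum_sig (x : V) : {sc : seq int * (int -> V) |
  [/\ uniq sc.1, forall i, grcomp i (sc.2 i) & x = \sum_(i <- sc.1) sc.2 i]}.
Proof. by apply: cid; have [s [c h]] := grcomp_sum x; exists (s, c). Qed.

(* Multiplication by the sign [(-1)^(e * |x|)] on homogeneous [x], extended
   linearly; see [ksign_homog]. *)
Definition ksign (e : int) (x : V) : V :=
  let: (s, c) := sval (grcomp_sum_sig x) in
  \sum_(i <- s) (-1) ^+ `|(e * i)%R|%N *: c i.

Lemma grcomp_extend (s t : seq int) (c : int -> V) (k : int -> R) :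
  uniq s -> uniq t -> {subset s <= t} ->
  \sum_(i <- s) k i *: c i =
  \sum_(i <- t) k i *: (if i \in s then c i else 0).
Proof.
move=> us ut st; have p : perm_eq [seq i <- t | i \in s] s.
  apply: uniq_perm => //; first exact: filter_uniq.
  by move=> i; rewrite mem_filter; case: (boolP (i \in s)) => //= /st.
rewrite -(perm_big _ p) big_filter big_mkcond /=.
by apply: eq_bigr => i _; case: ifP; rewrite ?scaler0.
Qed.

Lemma grcomp_sum_unique (s t : seq int) (c d : int -> V) (k : int -> R) :
  uniq s -> uniq t ->
  (forall i, grcomp i (c i)) -> (forall i, grcomp i (d i)) ->
  \sum_(i <- s) c i = \sum_(i <- t) d i ->
  \sum_(i <- s) k i *: c i = \sum_(i <- t) k i *: d i.
Proof.
move=> us ut hc hd.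
pose u := undup (s ++ t).
have uu : uniq u by apply: undup_uniq.
have su : {subset s <= u} by move=> i; rewrite mem_undup mem_cat => ->.
have tu : {subset t <= u} by move=> i; rewrite mem_undup mem_cat orbC => ->.
have E (r : seq int) (b : int -> V) : \sum_(i <- r) b i = \sum_(i <- r) (1 : R) *: b i.
  by apply: eq_bigr => i _; rewrite scale1r.
rewrite E [RHS]E (grcomp_extend _ _ us uu su) (grcomp_extend _ _ ut uu tu).
rewrite (grcomp_extend _ _ us uu su) (grcomp_extend _ _ ut uu tu).
rewrite -!E => /eqP; rewrite -subr_eq0 -sumrB => /eqP h.
apply: eq_big_seq => i iu; congr (_ *: _); apply/eqP.
rewrite -subr_eq0; apply/eqP; move: i iu; apply: grcomp_direct h => // i.
rewrite addrC -scaleN1r; apply: grcompP; case: ifP => // _; exact: grcomp0.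
Qed.

Lemma ksignE (e : int) (s : seq int) (c : int -> V) :
  uniq s -> (forall i, grcomp i (c i)) ->
  ksign e (\sum_(i <- s) c i) = \sum_(i <- s) (-1) ^+ `|(e * i)%R|%N *: c i.
Proof.
move=> us hc; rewrite /ksign; case: grcomp_sum_sig => -[t d] /= [ut hd h].
exact: grcomp_sum_unique.
Qed.

Lemma ksign_homog (e i : int) (x : V) :
  grcomp i x -> ksign e x = (-1) ^+ `|(e * i)%R|%N *: x.
Proof.
move=> hx; pose c j : V := if j == i then x else 0.
have hc j : grcomp j (c j) by rewrite /c; case: eqP => [->|_] //; apply: grcomp0.
have := @ksignE e [:: i] c isT hc.
by rewrite !big_seq1 /c eqxx.
Qed.

Lemma ksign_linear (e : int) : linear (ksign e).
Proof.
move=> a x y.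
have [s [c [us hc ->]]] := grcomp_sum x.
have [t [d [ut hd ->]]] := grcomp_sum y.
pose u := undup (s ++ t).
have uu : uniq u by apply: undup_uniq.
have su : {subset s <= u} by move=> i; rewrite mem_undup mem_cat => ->.
have tu : {subset t <= u} by move=> i; rewrite mem_undup mem_cat orbC => ->.
have E (r : seq int) (b : int -> V) : \sum_(i <- r) b i = \sum_(i <- r) (1 : R) *: b i.
  by apply: eq_bigr => i _; rewrite scale1r.
pose cs i := if i \in s then c i else 0.
pose dt i := if i \in t then d i else 0.
have hcs i : grcomp i (cs i) by rewrite /cs; case: ifP => // _; apply: grcomp0.
have hdt i : grcomp i (dt i) by rewrite /dt; case: ifP => // _; apply: grcomp0.
have -> : \sum_(i <- s) c i = \sum_(i <- u) cs i.
  by rewrite E (grcomp_extend _ _ us uu su) -E.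
have -> : \sum_(i <- t) d i = \sum_(i <- u) dt i.
  by rewrite E (grcomp_extend _ _ ut uu tu) -E.
rewrite scaler_sumr -big_split /= !ksignE //; last by move=> i; apply: grcompP.
rewrite scaler_sumr -big_split /=; apply: eq_bigr => i _.
by rewrite scalerDr !scalerA mulrC.
Qed.

HB.instance Definition _ (e : int) :=
  GRing.isLinear.Build R V V *:%R (ksign e) (ksign_linear e).

(* The grading of [V^(⊗n)]: the degree [m] component is spanned by the
   [v_1 ⊗ ... ⊗ v_n] with homogeneous [v_j] such that [|v_1| + ... + |v_n| = m]. *)
Inductive tcomp (n : nat) (m : int) : tpow V n -> Prop :=
| tcomp0 : tcomp m 0
| tcompP a x y : tcomp m x -> tcomp m y -> tcomp m (a *: x + y)
| tcomp_pure (d : 'I_n -> int) (v : n.-tuple V) :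
    (forall j, grcomp (d j) (tnth v j)) -> \sum_j d j = m -> tcomp m (pure v).

End Koszul.

Definition has_degree (A B : Type) (CA : int -> A -> Prop)
    (CB : int -> B -> Prop) (d : int) (f : A -> B) : Prop :=
  forall i x, CA i x -> CB (i + d) (f x).

Definition hom_degree (R : comPzRingType) (V W : grmod R) (d : int)
    (f : V -> W) : Prop :=
  has_degree (@grcomp R V) (@grcomp R W) d f.

Definition thom_degree (R : comPzRingType) (V : grmod R) (n : nat) (d : int)
    (f : tpow V n -> V) : Prop :=
  has_degree (@tcomp R V n) (@grcomp R V) d f.

(** * Tensor products of graded maps *)

(* A factor [f : V^(⊗r) -> V] of a tensor product of maps; [fdeg] is its degree
   (not enforced here), which enters the Koszul sign. *)
Record factor (R : comPzRingType) (V : grmod R) := Factor {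
  farity : nat;
  fdeg : int;
  fmap : {linear tpow V farity -> V}
}.

Section TensorMaps.
Variables (R : comPzRingType) (V : grmod R).

(* [s_1 ⊗ ... ⊗ s_r], used only for lists [s] of size [r]. *)
Definition pure_seq (r : nat) (s : seq V) : tpow V r :=
  pure [tuple nth 0 s i | i < r].

(* The entries of the pure tensor [(f_1 ⊗ ... ⊗ f_k) (v_1 ⊗ ... ⊗ v_n)],
   computed by [(a ⊗ b) (x ⊗ y) = (-1)^(|x||b|) a x ⊗ b y] with [a = f_1],
   [b = f_2 ⊗ ... ⊗ f_k] and [x = v_1 ⊗ ... ⊗ v_r], [r] the arity of [f_1];
   the sign is distributed over the entries of [x] by [ksign |b|]. *)
Fixpoint tens_entries (fs : seq (factor V)) (v : seq V) : seq V :=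
  if fs is f :: fs' then
    fmap f (pure_seq (farity f)
      (map (ksign (\sum_(f' <- fs') fdeg f')) (take (farity f) v)))
    :: tens_entries fs' (drop (farity f) v)
  else [::].

Definition tens_fits (n k : nat) (fs : seq (factor V)) : bool :=
  (sumn (map (@farity R V) fs) == n) && (size fs == k).

Definition tens_pure (n k : nat) (fs : seq (factor V)) (v : n.-tuple V) :
    tpow V k :=
  if tens_fits n k fs then pure_seq k (tens_entries fs v) else 0.

Definition seq_multilinear (n : nat) (U : lmodType R) (phi : seq V -> U) :=
  forall s1 s2 a x y, (size s1 + (size s2).+1 = n)%N ->
  phi (s1 ++ (a *: x + y) :: s2) =
    a *: phi (s1 ++ x :: s2) + phi (s1 ++ y :: s2).

Lemma multilinear_seq (n : nat) (U : lmodType R) (phi : seq V -> U) :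
  seq_multilinear n phi -> multilinear (fun v : n.-tuple V => phi v).
Proof.
move=> hphi v i a x y.
have E z : tset v i z = take i v ++ z :: drop i.+1 v :> seq V.
  apply: (@eq_from_nth _ 0).
    rewrite size_tuple size_cat /= size_take size_drop size_tuple ltn_ord.
    by rewrite addnS -addSn subnKC.
  move=> j; rewrite size_tuple => jn.
  rewrite -[j]/(nat_of_ord (Ordinal jn)) -tnth_nth tnth_mktuple.
  rewrite (tnth_nth 0 v) -val_eqE /= nth_cat size_take size_tuple ltn_ord.
  case: (ltngtP j i) => [ji|ij|->]; first by rewrite nth_take.
    have -> : (j - i = (j - i.+1).+1)%N by rewrite -subSn // subSS.
    by rewrite /= nth_drop subnKC.
  by rewrite subnn.
rewrite !E hphi // size_take size_drop size_tuple ltn_ord.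
by rewrite addnS -addSn subnKC.
Qed.

Lemma pure_seq_multilinear (n : nat) : seq_multilinear n (pure_seq n).
Proof.
move=> s1 s2 a x y hn.
have i_lt : (size s1 < n)%N by rewrite -hn addnS ltnS leq_addr.
pose i := Ordinal i_lt; pose v := [tuple nth 0 (s1 ++ x :: s2) j | j < n].
have E z : [tuple nth 0 (s1 ++ z :: s2) j | j < n] = tset v i z.
  apply: eq_from_tnth => j; rewrite !tnth_mktuple !nth_cat.
  rewrite -val_eqE /=; case: (ltngtP j (size s1)) => // [ij|->].
    by rewrite -[(j - _)%N]prednK ?subn_gt0.
  by rewrite subnn.
by rewrite /pure_seq !E pure_multilinear.
Qed.

Lemma size_tens_entries fs v : size (tens_entries fs v) = size fs.
Proof. by elim: fs v => //= f fs IHfs v; rewrite IHfs. Qed.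

(* Changing one entry of the argument changes exactly one entry of the result,
   linearly. *)
Lemma tens_entries_split (fs : seq (factor V)) s1 s2 :
  (size s1 + (size s2).+1)%N = sumn (map (@farity R V) fs) ->
  exists (t1 t2 : seq V) (L : V -> V),
    [/\ linear L, (size t1 + (size t2).+1)%N = size fs &
        forall z, tens_entries fs (s1 ++ z :: s2) = t1 ++ L z :: t2].
Proof.
elim: fs s1 => [|f fs IHfs] s1 /=; first by rewrite addnS.
move=> hs; case: (ltnP (size s1) (farity f)) => hf.
- set e := \sum_(_ <- _) _; set r := farity f.
  have hr : (r - size s1 = (r - size s1).-1.+1)%N by rewrite prednK ?subn_gt0.
  set q := (r - size s1).-1 in hr.
  exists [::], (tens_entries fs (drop q s2)),
    (fun z => fmap f (pure_seq r (map (ksign e) s1 ++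
       ksign e z :: map (ksign e) (take q s2)))).
  split.
  + move=> a x y; rewrite linearP pure_seq_multilinear ?linearP //.
    rewrite !size_map size_takel.
      by rewrite -hr subnKC // ltnW.
    rewrite -ltnS -hr leq_subLR hs.
    by rewrite leq_addr.
  + by rewrite /= size_tens_entries.
  + move=> z /=; rewrite take_cat drop_cat ltnNge (ltnW hf) /=.
    by rewrite hr /= map_cat.
- have [|t1 [t2 [L [Llin ht hL]]]] := IHfs (drop (farity f) s1).
    rewrite size_drop; apply: (@addnI (farity f)).
    by rewrite addnA subnKC.
  exists (fmap f (pure_seq (farity f) (map (ksign (\sum_(f' <- fs) fdeg f'))
      (take (farity f) s1))) :: t1), t2, L.
  split=> //=; first by rewrite addSn ht.
  move=> z; rewrite take_cat drop_cat.
  move: hf; rewrite leq_eqVlt => /orP[/eqP hf|hf]; last by rewrite hf hL.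
  have -> : (farity f < size s1)%N = false by rewrite hf ltnn.
  have -> : (farity f - size s1)%N = 0 by rewrite hf subnn.
  have e1 : take (farity f) s1 = s1 by rewrite hf take_size.
  have e2 : drop (farity f) s1 = [::] by rewrite hf drop_size.
  by rewrite -hL e1 e2 take0 drop0 cats0.
Qed.

Lemma tens_pure_multilinear (n k : nat) (fs : seq (factor V)) :
  multilinear (@tens_pure n k fs).
Proof.
rewrite /tens_pure; case: (boolP (tens_fits n k fs)); last first.
  by move=> _ v i a x y; rewrite scaler0 addr0.
move=> /andP[/eqP hn /eqP hk].
apply: (@multilinear_seq n _ (fun v => pure_seq k (tens_entries fs v))).
move=> s1 s2 a x y hs; rewrite -hn in hs.
have [t1 [t2 [L [Llin ht hL]]]] := tens_entries_split hs.
by rewrite !hL Llin pure_seq_multilinear // ht.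
Qed.

(* [f_1 ⊗ ... ⊗ f_k : V^(⊗n) -> V^(⊗k)] when the arities of the factors add up
   to [n]; the zero map by convention otherwise. *)
Definition tensor (n k : nat) (fs : seq (factor V)) : tpow V n -> tpow V k :=
  tlift (@tens_pure_multilinear n k fs).

HB.instance Definition _ (n k : nat) (fs : seq (factor V)) :=
  GRing.Linear.on (@tensor n k fs).

Arguments tensor n k fs _ : clear implicits.

Definition id_factor : factor V := Factor 0 (@tpow1 R V).

(* [id^(⊗(i-1)) ⊗ f ⊗ id^(⊗(k-i)) : V^(⊗n) -> V^(⊗k)]. *)
Definition tensor_at (n k i : nat) (f : factor V) : tpow V n -> tpow V k :=
  tensor n k (nseq i.-1 id_factor ++ f :: nseq (k - i) id_factor).

HB.instance Definition _ (n k i : nat) (f : factor V) :=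
  GRing.Linear.on (@tensor_at n k i f).

End TensorMaps.

Arguments Factor {R V farity} fdeg fmap.
Arguments tensor {R V} n k fs _.
Arguments tensor_at {R V} n k i f _.
Arguments id_factor {R V}.

(** * Index sets and signs *)

(* Triples [(k, l, i)]; the bound [n] on the entries is no restriction. *)
Definition Aset (n : nat) : {set 'I_n.+1 * 'I_n.+1 * 'I_n.+1} :=
  [set t : 'I_n.+1 * 'I_n.+1 * 'I_n.+1 |
    let: (k, l, i) := t in
    [&& (k + l == n.+1)%N, 2 <= k, 2 <= l, 1 <= i & i <= k]%N].

(* The [(r_1, ..., r_k)] with [(k, r_1, ..., r_k)] in B(n), for fixed [k >= 2];
   the bound [n] on the entries is no restriction. *)
Definition Bset (n k : nat) : {set k.-tuple 'I_n.+1} :=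
  [set r : k.-tuple 'I_n.+1 |
    [forall j, 1 <= tnth r j]%N && (\sum_(j < k) tnth r j == n)%N].

Definition vartheta (k : nat) (u : 'I_k -> nat) : nat :=
  (\sum_(i < k) \sum_(j < k | i < j) u i * (u j).+1)%N.

(** * Chain complexes and A-infinity algebras *)

Record complex (R : comPzRingType) := Complex {
  cmod :> grmod R;
  diff : {linear cmod -> cmod};
  diff_degree : hom_degree (-1) diff;
  diff_diff : forall x, diff (diff x) = 0
}.

Arguments diff {R c}.

Definition chain_map (R : comPzRingType) (V W : complex R) (f : V -> W) : Prop :=
  hom_degree 0 f /\ forall x, f (diff x) = diff (f x).

Definition diff_factor (R : comPzRingType) (V : complex R) : factor V :=
  Factor (-1) (diff \o tpow1).

Arguments diff_factor {R V}.

(* Only the [mu n] with [2 <= n] are part of the structure. *)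
Definition Ainfinity (R : comPzRingType) (V : complex R)
    (mu : forall n : nat, {linear tpow V n -> V}) : Prop :=
  (forall n : nat, (2 <= n)%N -> thom_degree (n%:Z - 2) (mu n)) /\
  (forall n : nat, (2 <= n)%N -> forall x : tpow V n,
    diff (mu n x)
    - \sum_(1 <= i < n.+1) (-1) ^+ n *: mu n (tensor_at n n i diff_factor x)
    = \sum_(t in Aset n)
        let: (k, l, i) := t in
        (-1) ^+ (i * l.+1 + n)
        *: mu k (tensor_at n k i (Factor (l%:Z - 2) (mu l)) x)).

(* [h ∘ p_r], of degree [r - 1], with the convention [h ∘ p_1 = id]. *)
Definition hp_factor (R : comPzRingType) (V : grmod R) (h : {linear V -> V})
    (p : forall n : nat, {linear tpow V n -> V}) (r : nat) : factor V :=
  if r == 1%N then id_factor else Factor (r%:Z - 1) (h \o p r).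

(* Main.v *)
(* Desuspend: on pure tensors replace each operation phi of arity n by
   [(-1)^(n choose 2) phi (t^(n-1) v_1, ..., t v_(n-1), v_n)], where
   [t v = (-1)^|v| v].  All signs of the statement then collapse.  With
   [s = - t], the A-infinity relation reads
     sum over v = (a, b, c) of mu (s a, mu b, c) = 0   (with mu_1 = d),
   the maps p become sums over all cuttings of v into blocks with no sign, and
   the claim becomes
     d p(v) + sum over (a, b, c) with b <> v of p (s a, th b, c) = 0,
   where th is d on single vectors and gf p on longer ones.

   This is proved by induction on the length of v.  Put q = id on single vectors
   and q = h p on longer ones.  Applying the A-infinity relation to the q-images
   of the cuttings of v expands d p(v) into terms mu (s q.., B(w), q..), with
   B(w) the sum of mu (q, .., q) over all cuttings of w, that is p(w) + d q(w).
   Expanding p in the second sum gives the same terms with opposite sign,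
   provided that B(w) is the sum of q (s a, th b, c) over w = (a, b, c).  For w
   shorter than v this follows from the induction hypothesis and
   gf - id = dh + hd. *)

Require Import Defs.
From HB Require Import structures.
From mathcomp Require Import all_boot all_order all_algebra.
From mathcomp Require Import zify.
Import GRing.Theory.
Local Open Scope ring_scope.

Set Implicit Arguments.
Unset Strict Implicit.
Unset Printing Implicit Defensive.

(** * Cuttings of a list in two, and compositions into nonempty blocks *)

Fixpoint cuts {T : Type} (s : seq T) : seq (seq T * seq T) :=
  if s is x :: s' then ([::], s) :: [seq (x :: u.1, u.2) | u <- cuts s']
  else [:: ([::], [::])].

(* The head [x] is a block of its own or joins the first block. *)
Fixpoint comps {T : Type} (s : seq T) : seq (seq (seq T)) :=
  if s is x :: s' then
    [seq [:: x] :: c | c <- comps s'] ++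
    [seq (x :: head [::] c) :: behead c | c <- comps s' & ~~ nilp c]
  else [:: [::]].

Section Sums.
Context {U : nmodType} {T : Type}.
Implicit Types s : seq T.

Lemma big_cuts_cons (F : seq T * seq T -> U) x s :
  \sum_(u <- cuts (x :: s)) F u =
  F ([::], x :: s) + \sum_(u <- cuts s) F (x :: u.1, u.2).
Proof. by rewrite big_cons big_map. Qed.

Lemma big_comps_cons (F : seq (seq T) -> U) x s :
  \sum_(c <- comps (x :: s)) F c =
  \sum_(c <- comps s) (F ([:: x] :: c) +
    if c is b :: c' then F ((x :: b) :: c') else 0).
Proof.
rewrite /= big_cat /= !big_map big_filter [X in _ + X]big_mkcond -big_split /=.
by apply: eq_bigr => -[|b c] _; rewrite ?addr0.
Qed.

(** Coassociativity of deconcatenation: either way the sum runs once over each cutting of [s] into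
    three pieces. *)
Lemma cuts_coassoc (F : seq T -> seq T -> seq T -> U) s :
  \sum_(u <- cuts s) \sum_(w <- cuts u.1) F w.1 w.2 u.2 =
  \sum_(u <- cuts s) \sum_(w <- cuts u.2) F u.1 w.1 w.2.
Proof.
elim: s F => [|x s IHs] F; first by rewrite !big_seq1 /= ?big_seq1.
rewrite !big_cuts_cons /= big_seq1 /= -(IHs (fun a => F (x :: a))).
rewrite -addrA; congr (_ + _); rewrite -big_split /=.
by apply: eq_bigr => u _; rewrite big_cons big_map.
Qed.

(** A composition of [s] cut between two blocks is the same as a cutting of [s] together with a
    composition of each piece. *)
Lemma comps_cuts (F : seq (seq T) -> seq (seq T) -> U) s :
  \sum_(c <- comps s) \sum_(u <- cuts c) F u.1 u.2 =
  \sum_(u <- cuts s) \sum_(c <- comps u.1) \sum_(d <- comps u.2) F c d.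
Proof.
elim: s F => [|x s IHs] F; first by rewrite !big_seq1 /= ?big_seq1.
rewrite big_comps_cons big_cuts_cons /= big_seq1.
(* [G] adds [x] to the left part, as a block of its own or inside the first block; the terms with
   empty left part are kept apart. *)
pose G c d := F ([:: x] :: c) d + if c is b :: c' then F ((x :: b) :: c') d else 0.
transitivity (\sum_(d <- comps (x :: s)) F [::] d +
   \sum_(c <- comps s) \sum_(u <- cuts c) G u.1 u.2); last first.
  congr (_ + _); rewrite IHs; apply: eq_bigr => u _.
  rewrite big_comps_cons; apply: eq_bigr => -[|b c] _; rewrite big_split //=.
  by congr (_ + _); rewrite big1.
rewrite big_comps_cons -big_split /=; apply: eq_bigr => c _.
rewrite [X in X + _]big_cons big_map /= [X in _ = _ + X]big_split /= -!addrA.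
congr (_ + _); rewrite [RHS]addrCA; congr (_ + _).
case: c => [|b c]; first by rewrite big_seq1 addr0.
by rewrite !big_cons !big_map /= add0r.
Qed.

Lemma comps_head (F : seq (seq T) -> U) x s :
  \sum_(c <- comps (x :: s)) F c =
  \sum_(u <- cuts s) \sum_(c <- comps u.2) F ((x :: u.1) :: c).
Proof.
elim: s F x => [|y s IHs] F x.
  by rewrite !big_seq1.
rewrite big_comps_cons big_split /= big_cons /=; congr (_ + _).
by rewrite IHs big_map.
Qed.

(** [T] has no decidable equality, so the condition [u.1 ++ u.2 = s] stands in for membership in
    [cuts s]. *)
Lemma eq_big_cuts (F G : seq T * seq T -> U) s :
  (forall u, u.1 ++ u.2 = s -> F u = G u) ->
  \sum_(u <- cuts s) F u = \sum_(u <- cuts s) G u.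
Proof.
elim: s F G => [|x s IHs] F G FG; first by rewrite !big_seq1 FG.
rewrite !big_cuts_cons FG //; congr (_ + _); apply: IHs => u us.
by apply: FG; rewrite /= us.
Qed.

Lemma cuts_mark (F : seq T * seq T -> U) a y b :
  \sum_(u <- cuts (a ++ y :: b)) F u =
  \sum_(u <- cuts a) F (u.1, u.2 ++ y :: b) +
  \sum_(w <- cuts b) F (a ++ y :: w.1, w.2).
Proof.
elim: a F => [|x a IHa] F; first by rewrite big_seq1 big_cuts_cons.
by rewrite cat_cons !big_cuts_cons IHa addrA.
Qed.

(** Sorts the compositions by the block containing the marked entry [y], which takes an end [u.2] of
    [a] and a beginning [w.1] of [b]. *)
Lemma comps_mark (F : seq (seq T) -> U) a y b :
  \sum_(c <- comps (a ++ y :: b)) F c =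
  \sum_(u <- cuts a) \sum_(w <- cuts b)
    \sum_(c <- comps u.1) \sum_(d <- comps w.2)
      F (c ++ (u.2 ++ y :: w.1) :: d).
Proof.
have [n] := ubnP (size a); elim: n a F => // n IHn [|x a] F /= an.
  rewrite big_seq1 comps_head; apply: eq_bigr => w _.
  by rewrite big_seq1.
(* The first block ends either before [y] or after it; the induction hypothesis treats the first
   case. *)
rewrite comps_head cuts_mark big_cuts_cons addrC; congr (_ + _).
  2: by apply: eq_bigr => w _; rewrite big_seq1.
transitivity (\sum_(u <- cuts a) \sum_(u' <- cuts u.2) \sum_(w <- cuts b)
    \sum_(c <- comps u'.1) \sum_(d <- comps w.2)
      F ((x :: u.1) :: c ++ (u'.2 ++ y :: w.1) :: d)).
  apply: eq_big_cuts => u ua /=.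
  rewrite (IHn _ (fun c => F ((x :: u.1) :: c))) //.
  by rewrite -ua size_cat in an; lia.
rewrite -(cuts_coassoc (fun a1 a2 a3 => \sum_(w <- cuts b)
    \sum_(c <- comps a2) \sum_(d <- comps w.2)
      F ((x :: a1) :: c ++ (a3 ++ y :: w.1) :: d))).
apply: eq_bigr => u _; rewrite exchange_big; apply: eq_bigr => w _ /=.
by rewrite comps_head.
Qed.

Lemma comps_size (F : seq (seq T) -> U) x s :
  \sum_(c <- comps (x :: s)) F c =
  F [:: x :: s] + \sum_(c <- comps (x :: s) | (1 < size c)%N) F c.
Proof.
rewrite [in RHS]big_mkcond; elim: s x F => [|y s IHs] x F.
  by rewrite !big_seq1 addr0.
rewrite !(big_comps_cons _ x) IHs [in RHS]IHs /= addr0.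
rewrite (addrC (F [:: [:: x]; _])) -addrA; congr (_ + (_ + _)).
by apply: eq_bigr => -[|a [|b c]] _ /=; rewrite ?addr0.
Qed.

Lemma eq_big_comps (F G : seq (seq T) -> U) s :
  (forall c, flatten c = s -> all (predC (@nilp T)) c -> F c = G c) ->
  \sum_(c <- comps s) F c = \sum_(c <- comps s) G c.
Proof.
elim: s F G => [|x s IHs] F G FG; first by rewrite !big_seq1 FG.
rewrite !big_comps_cons; apply: IHs => c cs cn.
rewrite FG /= ?cs //; congr (_ + _); case: c cs cn => //= b c cs /andP[_ cn].
by apply: FG; rewrite /= ?cs.
Qed.

Lemma big_cuts_nil1 (F : seq T * seq T -> U) s :
  \sum_(u <- cuts s | nilp u.1) F u = F ([::], s).
Proof.
case: s => [|x s]; first by rewrite big_mkcond big_seq1.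
by rewrite big_mkcond big_cuts_cons /= big1 ?addr0.
Qed.

Lemma big_cuts_nil2 (F : seq T * seq T -> U) s :
  \sum_(u <- cuts s | nilp u.2) F u = F (s, [::]).
Proof.
elim: s F => [|x s IHs] F; first by rewrite big_mkcond big_seq1.
by rewrite big_mkcond big_cuts_cons /= add0r -big_mkcond IHs.
Qed.

End Sums.

(** * Cuttings in three pieces *)

Definition cut3 {T : Type} (s : seq T) : seq (seq T * seq T * seq T) :=
  [seq (u.1, w.1, w.2) | u <- cuts s, w <- cuts u.2].

(** The middle piece is nonempty and not the whole list: the range of the second sum in the
    sign-free claim. *)
Definition inner {T : Type} (t : seq T * seq T * seq T) : bool :=
  ~~ nilp t.1.2 && ~~ (nilp t.1.1 && nilp t.2).

Section Cut3.
Context {U : nmodType} {T : Type}.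
Implicit Types s : seq T.

Lemma big_cut3 (F : seq T * seq T * seq T -> U) s :
  \sum_(t <- cut3 s) F t =
  \sum_(u <- cuts s) \sum_(w <- cuts u.2) F (u.1, w.1, w.2).
Proof. exact: big_allpairs_dep. Qed.

Lemma eq_big_cut3 (F G : seq T * seq T * seq T -> U) s :
  (forall t, t.1.1 ++ t.1.2 ++ t.2 = s -> F t = G t) ->
  \sum_(t <- cut3 s) F t = \sum_(t <- cut3 s) G t.
Proof.
move=> FG; rewrite !big_cut3; apply: eq_big_cuts => u us.
by apply: eq_big_cuts => w wu; apply: FG; rewrite /= wu us.
Qed.

Lemma big_cut3_full (F : seq T * seq T * seq T -> U) s : ~~ nilp s ->
  \sum_(t <- cut3 s | ~~ nilp t.1.2) F t =
  F ([::], s, [::]) + \sum_(t <- cut3 s | inner t) F t.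
Proof.
move=> s0; rewrite (bigID (fun t => nilp t.1.1 && nilp t.2)) /=; congr (_ + _).
rewrite big_mkcond big_cut3 /=.
transitivity (\sum_(u <- cuts s | nilp u.1) \sum_(w <- cuts u.2 | nilp w.2)
    if ~~ nilp w.1 then F (u.1, w.1, w.2) else 0).
  rewrite [RHS]big_mkcond; apply: eq_bigr => u _; case: ifP => u0.
    rewrite [RHS]big_mkcond; apply: eq_bigr => w _.
    by rewrite /= andbC; case: (nilp w.2); case: (nilp w.1).
  by rewrite big1 // => w _; rewrite /= andbF.
by rewrite big_cuts_nil1 big_cuts_nil2 s0.
Qed.

End Cut3.

Section Cut3Comps.
Context {U : nmodType} {T : Type}.
Implicit Types s : seq T.

Lemma comps_cut3
    (F : seq (seq T) * seq (seq T) * seq (seq T) -> U) s :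
  \sum_(c <- comps s) \sum_(w <- cut3 c) F w =
  \sum_(t <- cut3 s) \sum_(c1 <- comps t.1.1) \sum_(c2 <- comps t.1.2)
    \sum_(c3 <- comps t.2) F (c1, c2, c3).
Proof.
under eq_bigr => c _ do rewrite big_cut3.
rewrite (comps_cuts (fun c d => \sum_(w <- cuts d) F (c, w.1, w.2))) big_cut3.
apply: eq_bigr => u _; rewrite [RHS]exchange_big; apply: eq_bigr => c1 _ /=.
by rewrite (comps_cuts (fun c2 c3 => F (c1, c2, c3))).
Qed.

(** Both sides run over the cuttings of [s] into five pieces: the left one singles out the middle
    piece first, the right one the middle three together. *)
Lemma cut3_nest (F : seq T -> seq T -> seq T -> seq T -> seq T -> U) s :
  \sum_(t <- cut3 s) \sum_(a <- cuts t.1.1) \sum_(b <- cuts t.2)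
    F a.1 a.2 t.1.2 b.1 b.2 =
  \sum_(t <- cut3 s) \sum_(w <- cut3 t.1.2) F t.1.1 w.1.1 w.1.2 w.2 t.2.
Proof.
rewrite !big_cut3 /=.
under eq_bigr => u _ do rewrite exchange_big /=.
rewrite (cuts_coassoc (fun a1 a2 r => \sum_(w <- cuts r)
  \sum_(b <- cuts w.2) F a1 a2 w.1 b.1 b.2)).
apply: eq_bigr => u _.
under [in RHS]eq_bigr => v _ do rewrite big_cut3 /=.
rewrite (cuts_coassoc (fun a r c => \sum_(g <- cuts r)
  F u.1 a g.1 g.2 c)).
by apply: eq_bigr => w _; rewrite (cuts_coassoc (F u.1 w.1)).
Qed.

End Cut3Comps.

Section CutMap.
Context {U : nmodType} {T T' : Type}.
Variable f : T -> T'.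

Lemma big_cuts_map (F : seq T' * seq T' -> U) s :
  \sum_(u <- cuts (map f s)) F u =
  \sum_(u <- cuts s) F (map f u.1, map f u.2).
Proof.
elim: s F => [|x s IHs] F; first by rewrite !big_seq1.
by rewrite /= !big_cons !big_map IHs.
Qed.

Lemma big_cut3_map (F : seq T' * seq T' * seq T' -> U) s :
  \sum_(t <- cut3 (map f s)) F t =
  \sum_(t <- cut3 s) F (map f t.1.1, map f t.1.2, map f t.2).
Proof.
rewrite !big_cut3 big_cuts_map; apply: eq_bigr => u _.
by rewrite (big_cuts_map (fun w => F (map f u.1, w.1, w.2))).
Qed.

Lemma big_comps_map (F : seq (seq T') -> U) s :
  \sum_(c <- comps (map f s)) F c = \sum_(c <- comps s) F (map (map f) c).
Proof.
elim: s F => [|x s IHs] F; first by rewrite !big_seq1.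
by rewrite map_cons !big_comps_cons IHs; apply: eq_bigr => -[|b c] _.
Qed.

End CutMap.

(** * The transfer relation without signs *)

Section ShiftedTransfer.
Variables (V : zmodType) (sg D H : {additive V -> V}) (G : V -> V).
Variables b P : seq V -> V.
Implicit Types s : seq V.

(** [kernel_of] and [transferred] are the maps q and th of the overview. Here [b] stands for the
    twisted operations, [P] for the twisted p, [sg] for s, and [D], [H], [G] for d, h, gf. *)
Definition kernel_of s : V := if s is [:: v] then v else H (P s).
Definition transferred s : V := if s is [:: v] then D v else G (P s).
Local Notation q := kernel_of.
Local Notation th := transferred.

Hypothesis b1 : forall v, b [:: v] = D v.
Hypothesis bD : forall s1 x y s2,
  b (s1 ++ (x + y) :: s2) = b (s1 ++ x :: s2) + b (s1 ++ y :: s2).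
Hypothesis b_ainf : forall s, (1 < size s)%N ->
  \sum_(t <- cut3 s | ~~ nilp t.1.2) b (map sg t.1.1 ++ b t.1.2 :: t.2) = 0.
Hypothesis homotopy : forall x, G x = x + D (H x) + H (D x).
Hypothesis P_rec : forall s, (1 < size s)%N ->
  P s = \sum_(c <- comps s | (1 < size c)%N) b (map q c).
Hypothesis q_sg : forall s, ~~ nilp s -> q (map sg s) = sg (q s).

Lemma b_sum (I : Type) (r : seq I) (Q : pred I) (F : I -> V) s1 s2 :
  b (s1 ++ (\sum_(i <- r | Q i) F i) :: s2) =
  \sum_(i <- r | Q i) b (s1 ++ F i :: s2).
Proof.
rewrite -!(big_filter r Q); move: (filter Q r) => {}r.
have b0 : b (s1 ++ 0 :: s2) = 0.
  by apply: (@addrI _ (b (s1 ++ 0 :: s2))); rewrite -bD !addr0.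
elim: r => [|i r IHr]; first by rewrite !big_nil.
by rewrite !big_cons bD IHr.
Qed.

Lemma kernel_of_gt1 s : (1 < size s)%N -> q s = H (P s).
Proof. by case: s => [|? []]. Qed.

Lemma transferred_gt1 s : (1 < size s)%N -> th s = G (P s).
Proof. by case: s => [|? []]. Qed.

(** The left side is B(s). On a single vector both sides are [D v]. Otherwise the full middle piece
    contributes [G (P s)], which [homotopy] expands into B(s) plus [H (D (P s))]; the inner terms
    are [H] of a sum that the hypothesis equates with [- D (P s)]. *)
Lemma comps_transferred s : ~~ nilp s ->
  ((1 < size s)%N -> D (P s) + \sum_(t <- cut3 s | inner t)
     P (map sg t.1.1 ++ th t.1.2 :: t.2) = 0) ->
  \sum_(c <- comps s) b (map q c) =
  \sum_(t <- cut3 s | ~~ nilp t.1.2) q (map sg t.1.1 ++ th t.1.2 :: t.2).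
Proof.
case: s => // v s _ IH; rewrite comps_size big_cut3_full //.
rewrite -[map q [:: v :: s]]/[:: q (v :: s)] -[map sg _ ++ _]/[:: th (v :: s)] b1.
case: (posnP (size s)) => [/size0nil s0|s0].
  by rewrite s0 /cut3 /inner /= !big_mkcond !big_cons !big_nil /= !addr0.
have vs : (1 < size (v :: s))%N by [].
rewrite -P_rec // kernel_of_gt1 // transferred_gt1 // homotopy addrC -addrA.
rewrite -[LHS]addr0 -!addrA; congr (_ + (_ + _)).
have -> : \sum_(t <- cut3 (v :: s) | inner t) q (map sg t.1.1 ++ th t.1.2 :: t.2)
   = H (\sum_(t <- cut3 (v :: s) | inner t) P (map sg t.1.1 ++ th t.1.2 :: t.2)).
  rewrite raddf_sum; apply: eq_bigr => t; rewrite /inner => /andP[_ t0].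
  rewrite kernel_of_gt1 // size_cat size_map /=.
  by case: t t0 => [[[|? ?] ?] [|? ?]] //= _; lia.
by rewrite -raddfD IH // raddf0.
Qed.

Lemma transfer_shifted s : (1 < size s)%N ->
  D (P s) + \sum_(t <- cut3 s | inner t) P (map sg t.1.1 ++ th t.1.2 :: t.2) = 0.
Proof.
have [n] := ubnP (size s); elim: n s => // n IHn s sn s1.
have inner_gt1 (T : Type) (t : seq T * seq T * seq T) :
    inner t -> (1 < size (t.1.1 ++ t.1.2 ++ t.2))%N.
  by case: t => [[[|? ?] [|? ?]] [|? ?]] //=; rewrite ?size_cat //=; lia.
(* The second sum of the claim: [P] is expanded over compositions, and the blocks through the marked
   entry add up to B([t.1.2]). *)
have eqP : \sum_(t <- cut3 s | inner t) P (map sg t.1.1 ++ th t.1.2 :: t.2) =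
    \sum_(t <- cut3 s | inner t) \sum_(c1 <- comps t.1.1) \sum_(c3 <- comps t.2)
      b (map sg (map q c1) ++ (\sum_(c <- comps t.1.2) b (map q c)) :: map q c3).
  (* The five pieces of [s] are [a1], [a2], [s2], [b1], [b2]; the marked block consists of [a2], th
     [s2] and [b1]. The second condition says that there is more than one block. *)
  pose K a1 a2 s2 b1 b2 : V := if ~~ nilp s2 && ~~ (nilp a1 && nilp b2)
    then \sum_(c1 <- comps a1) \sum_(c3 <- comps b2)
      b (map q (map (map sg) c1) ++ q (map sg a2 ++ th s2 :: b1) :: map q c3)
    else 0.
  transitivity (\sum_(t <- cut3 s) \sum_(a <- cuts t.1.1) \sum_(b <- cuts t.2)
    K a.1 a.2 t.1.2 b.1 b.2).
    rewrite big_mkcond; apply: eq_big_cut3 => t ts.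
    case: ifP => ti; last first.
      rewrite (eq_big_cuts (G := fun=> 0)) ?big1 // => a ta.
      rewrite (eq_big_cuts (G := fun=> 0)) ?big1 // => d td.
      move: ti; rewrite /K /inner -ta -td /nilp !size_cat !addn_eq0.
      by case: ifP => // /andP[-> /negbTE]; case: eqP; case: eqP => //=; rewrite ?andbF.
    have ts1 : (1 < size (map sg t.1.1 ++ th t.1.2 :: t.2))%N.
      case: t ti {ts} => [[t1 t2] t3]; rewrite /inner /= size_cat size_map /=.
      by case: t1 => [|? ?]; case: t3 => [|? ?] //=; rewrite ?andbF //=; lia.
    have {ti} /andP[t0 _] := ti.
    rewrite P_rec // big_mkcond comps_mark big_cuts_map.
    apply: eq_bigr => a _; apply: eq_bigr => d _; rewrite /= big_comps_map /K t0 /=.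
    transitivity (\sum_(c1 <- comps a.1) \sum_(c3 <- comps d.2)
       if ~~ (nilp a.1 && nilp d.2) then
         b (map q (map (map sg) c1) ++ q (map sg a.2 ++ th t.1.2 :: d.1) :: map q c3)
       else 0); last first.
      by case: ifP => // _; rewrite big1 // => c1 _; rewrite big1.
    apply: eq_big_comps => c1 ca c1n; apply: eq_big_comps => c3 cd c3n.
    rewrite size_cat size_map /= map_cat /=.
    have -> : nilp a.1 = nilp c1 by rewrite -ca; case: c1 c1n {ca} => [|[] ].
    have -> : nilp d.2 = nilp c3 by rewrite -cd; case: c3 c3n {cd} => [|[] ].
    by case: c1 {ca c1n} => [|? ?]; case: c3 {cd c3n} => [|? ?] //=; rewrite addnS.
  (* From here on [t.1.2] is the part of [s] covered by the marked block, and it is itself cut into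
     the three pieces of [w]. *)
  rewrite cut3_nest [RHS]big_mkcond; apply: eq_big_cut3 => t ts.
  case: ifP => ti; last first.
    rewrite (eq_big_cut3 (G := fun=> 0)) ?big1 // => w tw.
    move: ti; rewrite /K /inner -tw /nilp !size_cat !addn_eq0.
    by case: ifP => // /andP[/negbTE-> /negbTE->]; rewrite !andbF.
  have /andP[t0 t13] := ti.
  transitivity (\sum_(w <- cut3 t.1.2 | ~~ nilp w.1.2)
      \sum_(c1 <- comps t.1.1) \sum_(c3 <- comps t.2)
      b (map sg (map q c1) ++ q (map sg w.1.1 ++ th w.1.2 :: w.2) :: map q c3)).
    rewrite [RHS]big_mkcond; apply: eq_bigr => w _; rewrite /K t13 andbT.
    case: ifP => // _; apply: eq_big_comps => c1 _ c1n; apply: eq_bigr => c3 _.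
    congr (b (_ ++ _)); elim: c1 c1n => //= a c1 IHc /andP[an c1n].
    by rewrite q_sg // IHc.
  rewrite exchange_big; apply: eq_bigr => c1 _.
  rewrite exchange_big; apply: eq_bigr => c3 _.
  (* [inner t] makes [t.1.2] shorter than [s], so the induction hypothesis applies to it. *)
  rewrite -b_sum comps_transferred // => t21; apply: IHn => //.
  move: ti sn; rewrite -ts !size_cat /inner /nilp => /andP[_].
  by case: (size t.1.1) (size t.2) => [|?] [|?] //=; lia.
rewrite eqP.
(* The relation for [b], applied to the q-images of every composition of [s] with more than one
   block. *)
have : \sum_(c <- comps s | (1 < size c)%N)
    \sum_(t <- cut3 (map q c) | ~~ nilp t.1.2)
    b (map sg t.1.1 ++ b t.1.2 :: t.2) = 0.
  by rewrite big1 // => c c1; rewrite b_ainf // size_map.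
move=> E; rewrite -[RHS]E P_rec // raddf_sum /= {E}.
(* The cutting whose middle piece is all of [c] is split off; summed over [c] it gives [D (P s)]. *)
transitivity (\sum_(c <- comps s | (1 < size c)%N) (b [:: b (map q c)] +
    \sum_(t <- cut3 c | inner t)
      b (map sg (map q t.1.1) ++ b (map q t.1.2) :: map q t.2))); last first.
  apply: eq_bigr => c c1; rewrite [RHS]big_mkcond big_cut3_map -[RHS]big_mkcond /=.
  rewrite -(big_cut3_full (fun t =>
    b (map sg (map q t.1.1) ++ b (map q t.1.2) :: map q t.2))).
    by apply: eq_bigl => t; rewrite /nilp size_map.
  by case: c c1.
rewrite big_split /=; congr (_ + _).
  by apply: eq_bigr => c _; rewrite b1.
pose M (t : seq (seq V) * seq (seq V) * seq (seq V)) := if inner t then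
  b (map sg (map q t.1.1) ++ b (map q t.1.2) :: map q t.2) else 0.
transitivity (\sum_(c <- comps s) \sum_(t <- cut3 c) M t); last first.
  rewrite [RHS]big_mkcond; apply: eq_bigr => c _; rewrite [in RHS]big_mkcond.
  case: ifP => // c1; rewrite (eq_big_cut3 (G := fun=> 0)) ?big1 // => t tc.
  by rewrite /M; case: ifP => // /inner_gt1; rewrite tc c1.
rewrite comps_cut3 big_mkcond; apply: eq_bigr => t _.
transitivity (\sum_(c1 <- comps t.1.1) \sum_(c2 <- comps t.1.2)
    \sum_(c3 <- comps t.2) if inner t then
  b (map sg (map q c1) ++ b (map q c2) :: map q c3) else 0).
  case: ifP => // ti; last first.
    by rewrite big1 // => *; rewrite big1 // => *; rewrite big1.
  apply: eq_bigr => c1 _; rewrite exchange_big; apply: eq_bigr => c2 _.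
  by rewrite b_sum.
apply: eq_big_comps => c1 t1 c1n; apply: eq_big_comps => c2 t2 c2n.
apply: eq_big_comps => c3 t3 c3n; rewrite /M /inner /= -t1 -t2 -t3.
have nf (c : seq (seq V)) : all (predC (@nilp V)) c -> nilp (flatten c) = nilp c.
  by case: c => [|[]].
by rewrite !nf.
Qed.

End ShiftedTransfer.

(** * Parities and Koszul signs *)

Lemma odd_abszD (a b : int) : odd `|(a + b)%R|%N = odd `|a|%N (+) odd `|b|%N.
Proof. by lia. Qed.

Lemma sign_congr (R : pzRingType) (m n : nat) :
  odd m = odd n -> (-1) ^+ m = (-1) ^+ n :> R.
Proof. by move=> mn; rewrite -signr_odd mn signr_odd. Qed.

Lemma bin2D (m n : nat) : 'C(m + n, 2) = ('C(m, 2) + 'C(n, 2) + m * n)%N.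
Proof.
elim: m => [|m IHm]; first by rewrite !add0n mul0n addn0.
by rewrite addSn !binS IHm !bin1; lia.
Qed.

Section KoszulSigns.
Context {R : comPzRingType} {V : grmod R}.
Implicit Types (e d : int) (x : V) (s : seq V).

Lemma homog_ext (U : lmodType R) (f g : {linear V -> U}) :
  (forall i x, grcomp i x -> f x = g x) -> f =1 g.
Proof.
move=> fg x; have [s [c [_ hc ->]]] := grcomp_sum x.
by rewrite !linear_sum; apply: eq_bigr => i _; apply: fg (hc i).
Qed.

Lemma ksign_odd e d x : odd `|e|%N = odd `|d|%N -> ksign e x = ksign d x.
Proof.
move=> ed; apply: (homog_ext (f := ksign e : {linear V -> V})
  (g := ksign d : {linear V -> V})) => i y yi /=.
rewrite !(ksign_homog _ yi); congr (_ *: _).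
by apply: sign_congr; rewrite !abszM !oddM ed.
Qed.

Lemma ksignD e d x : ksign e (ksign d x) = ksign (e + d) x.
Proof.
apply: (homog_ext (f := ksign e \o ksign d : {linear V -> V})
  (g := ksign (e + d) : {linear V -> V})) => i y yi /=.
rewrite !(ksign_homog _ yi) linearZ /= (ksign_homog _ yi) scalerA -exprD.
by congr (_ *: _); apply: sign_congr; rewrite mulrDl oddD odd_abszD addbC.
Qed.

Lemma ksign0 x : ksign 0 x = x.
Proof.
apply: (homog_ext (f := ksign 0 : {linear V -> V})
  (g := idfun : {linear V -> V})) => i y yi /=.
by rewrite (ksign_homog _ yi) mul0r scale1r.
Qed.

Lemma ksignK e x : ksign e (ksign e x) = x.
Proof.
by rewrite ksignD -[RHS]ksign0; apply: ksign_odd; rewrite odd_abszD addbb.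
Qed.

(** On [x] of degree i the exponents are e i and e d + e (i + d), which have the same parity. *)
Lemma hom_degree_ksign (W : grmod R) d (f : {linear V -> W}) e x :
  hom_degree d f -> f (ksign e x) = (-1) ^+ `|(e * d)%R|%N *: ksign e (f x).
Proof.
move=> fd; apply: (homog_ext (f := f \o ksign e : {linear V -> W})
  (g := (-1) ^+ `|(e * d)%R|%N \*: (ksign e \o f) : {linear V -> W})).
move=> i y yi /=; rewrite (ksign_homog _ yi) (ksign_homog _ (fd _ _ yi)).
rewrite linearZ scalerA -exprD; congr (_ *: _); apply: sign_congr.
by rewrite oddD mulrDr odd_abszD addbCA addbb addbF.
Qed.

End KoszulSigns.

(** * Multilinear functions of lists *)

Section SeqMultilinear.
Context {R : comPzRingType} {V : grmod R} {U : lmodType R}.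
Variables (n : nat) (phi : seq V -> U).
Hypothesis phiM : seq_multilinear n phi.

Lemma seq_multilinear0 s1 s2 :
  (size s1 + (size s2).+1)%N = n -> phi (s1 ++ 0 :: s2) = 0.
Proof.
move=> hn; have := phiM 1 0 0 hn.
by rewrite scale1r addr0 scale1r -[LHS]addr0 => /addrI.
Qed.

Lemma seq_multilinearZ s1 s2 a x : (size s1 + (size s2).+1)%N = n ->
  phi (s1 ++ a *: x :: s2) = a *: phi (s1 ++ x :: s2).
Proof. by move=> hn; rewrite -[a *: x]addr0 phiM // seq_multilinear0 // addr0. Qed.

Lemma seq_multilinear_sum (I : Type) (r : seq I) (F : I -> V) s1 s2 :
  (size s1 + (size s2).+1)%N = n ->
  phi (s1 ++ (\sum_(i <- r) F i) :: s2) = \sum_(i <- r) phi (s1 ++ F i :: s2).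
Proof.
move=> hn; elim: r => [|i r IHr]; first by rewrite !big_nil seq_multilinear0.
by rewrite !big_cons -[F i]scale1r phiM // IHr !scale1r.
Qed.

End SeqMultilinear.

Section SeqMultilinearMore.
Context {R : comPzRingType} {V : grmod R} {U : lmodType R}.
Implicit Types (phi : seq V -> U) (s : seq V).

Lemma seq_multilinear_cons n phi x :
  seq_multilinear n.+1 phi -> seq_multilinear n (fun s => phi (x :: s)).
Proof.
move=> phiM s1 s2 a y z hn.
by rewrite -!cat_cons phiM //= addSn hn.
Qed.

Lemma seq_multilinear_map n phi (f : {linear V -> V}) :
  seq_multilinear n phi -> seq_multilinear n (fun s => phi (map f s)).
Proof.
move=> phiM s1 s2 a x y hn.
by rewrite !map_cat /= linearP phiM // !size_map.
Qed.

Lemma seq_multilinear_comp n phi (W : lmodType R) (f : {linear U -> W}) :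
  seq_multilinear n phi -> seq_multilinear n (fun s => f (phi s)).
Proof. by move=> phiM s1 s2 a x y hn; rewrite phiM // linearP. Qed.

(** Entries are decomposed one at a time from the left; [s1] in the proof is the part already
    homogeneous. Past the end [nth] returns 0, homogeneous of every degree, so [j] carries no
    bound. *)
Lemma seq_multilinear_homog_ext n phi psi :
  seq_multilinear n phi -> seq_multilinear n psi ->
  (forall (ds : seq int) s, size ds = n -> size s = n ->
    (forall j, grcomp (nth 0 ds j) (nth 0 s j)) -> phi s = psi s) ->
  forall s, size s = n -> phi s = psi s.
Proof.
move=> phiM psiM hom s.
suff H s2 ds s1 : size ds = size s1 -> (size s1 + size s2)%N = n ->
    (forall j, grcomp (nth 0 ds j) (nth 0 s1 j)) -> phi (s1 ++ s2) = psi (s1 ++ s2).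
  by move=> sn; apply: (H s [::] [::]) => // j; rewrite !nth_nil; apply: grcomp0.
elim: s2 ds s1 => [|x s2 IH] ds s1 hs hn hd.
  by rewrite cats0; apply: (hom ds); rewrite ?hs // -hn addn0.
have [t [c [_ hc ->]]] := grcomp_sum x.
rewrite (seq_multilinear_sum phiM) // (seq_multilinear_sum psiM) //.
apply: eq_bigr => i _; rewrite -!cat_rcons; apply: (IH (rcons ds i)).
- by rewrite !size_rcons hs.
- by rewrite size_rcons -hn addSnnS.
move=> j; rewrite !nth_rcons hs; case: ltngtP => // _.
exact: grcomp0.
Qed.

Lemma seq_multilinear_ksign n phi e (ds : seq int) s :
  seq_multilinear n phi -> size ds = n -> size s = n ->
  (forall j, grcomp (nth 0 ds j) (nth 0 s j)) ->
  phi (map (ksign e) s) = (-1) ^+ `|(e * \sum_(d <- ds) d)%R|%N *: phi s.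
Proof.
elim: s n ds phi => [|x s IHs] n [|d ds] phi phiM hd hs hom.
- by rewrite big_nil mulr0 scale1r.
- by rewrite -hs in hd.
- by rewrite -hd in hs.
rewrite /= (ksign_homog _ (hom 0%N)) /=.
rewrite (seq_multilinearZ phiM (s1 := [::])) ?size_map //=.
case: n phiM hd hs => // n phiM [hd] [hs].
rewrite (IHs _ _ _ (seq_multilinear_cons x phiM) hd hs) => [|j]; last first.
  exact: (hom j.+1).
rewrite scalerA -exprD big_cons; congr (_ *: _); apply: sign_congr.
by rewrite oddD mulrDr odd_abszD.
Qed.

End SeqMultilinearMore.

(** * Koszul signs of factors and of their tensor products *)

Section Factors.
Context {R : comPzRingType} {V : grmod R}.
Implicit Types (s : seq V) (f : factor V) (fs : seq (factor V)).

(* The only consequence of homogeneity of [f] that the proof uses. *)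
Definition koszul_factor f : Prop := forall (e : int) s, size s = farity f ->
  fmap f (pure_seq (farity f) (map (ksign e) s)) =
  (-1) ^+ `|(e * fdeg f)%R|%N *: ksign e (fmap f (pure_seq (farity f) s)).

(** On homogeneous entries of total degree m the exponents are e m on the left and e d + e (m + d)
    on the right. Multilinearity gives the general case. *)
Lemma thom_degree_koszul_factor n d (psi : {linear tpow V n -> V}) :
  thom_degree d psi -> koszul_factor (Factor d psi).
Proof.
move=> psid e s /= sn.
have pM := seq_multilinear_comp psi (@pure_seq_multilinear R V n).
pose rhs s := ((-1) ^+ `|(e * d)%R|%N \*: ksign e) (psi (pure_seq n s)).
apply: (seq_multilinear_homog_ext (psi := rhs) (seq_multilinear_map _ pM)) => //.
  exact: (seq_multilinear_comp _ pM).
move=> ds {sn}s dn sn hom; rewrite (seq_multilinear_ksign e pM dn sn hom) /rhs /=.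
have tc : tcomp (\sum_(i < n) nth 0 ds i) (pure_seq n s).
  by apply: (tcomp_pure (d := fun i : 'I_n => nth 0 ds i)) => // j;
    rewrite tnth_mktuple.
rewrite (ksign_homog _ (psid _ _ tc)) scalerA -exprD; congr (_ *: _).
apply: sign_congr; rewrite (big_nth 0) dn big_mkord oddD mulrDr odd_abszD.
by rewrite addbCA addbb addbF.
Qed.

Lemma koszul_factor_comp n d d' (a : {linear V -> V}) (psi : {linear tpow V n -> V}) :
  hom_degree d a -> koszul_factor (Factor d' psi) -> koszul_factor (Factor (d' + d) (a \o psi)).
Proof.
move=> ad psid e s sn /=; rewrite psid //= linearZ /= (hom_degree_ksign _ _ ad).
rewrite scalerA -exprD; congr (_ *: _); apply: sign_congr.
by rewrite oddD mulrDr odd_abszD.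
Qed.

Lemma tpow1_pure_seq (x : V) : tpow1 (pure_seq 1 [:: x]) = x.
Proof. by rewrite /tpow1 /pure_seq tlift_pure tnth_mktuple. Qed.

Lemma id_koszul_factor : koszul_factor id_factor.
Proof.
by move=> e [|x [|y s]] //= _; rewrite !tpow1_pure_seq mulr0 scale1r.
Qed.

Lemma mktuple_seq n s : size s = n -> [tuple nth 0 s i | i < n] = s :> seq V.
Proof.
move=> sn; apply: (@eq_from_nth _ 0); rewrite size_tuple // => i ni.
by rewrite -[i]/(nat_of_ord (Ordinal ni)) -tnth_nth tnth_mktuple.
Qed.

Lemma tensor_pure_seq n k fs s : size s = n ->
  sumn (map (@farity R V) fs) = n -> size fs = k ->
  tensor n k fs (pure_seq n s) = pure_seq k (tens_entries fs s).
Proof.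
move=> sn fn fk; rewrite /tensor tlift_pure /tens_pure /tens_fits fn fk !eqxx /=.
by rewrite mktuple_seq.
Qed.

(** The rule of [koszul_factor] for a whole tensor product. The sign of each factor arises in its
    own entry; the multilinear [phi] lets all of them be collected in front. *)
Lemma tens_entries_ksign (U : lmodType R) (phi : seq V -> U) fs s e :
  seq_multilinear (size fs) phi -> size s = sumn (map (@farity R V) fs) ->
  (forall i, (i < size fs)%N -> koszul_factor (nth id_factor fs i)) ->
  phi (tens_entries fs (map (ksign e) s)) =
  (-1) ^+ `|(e * \sum_(f <- fs) fdeg f)%R|%N *:
  phi (map (ksign e) (tens_entries fs s)).
Proof.
elim: fs s phi => [|f fs IHfs] s phi phiM hs hf.
  by rewrite big_nil mulr0 scale1r.
rewrite /= -!map_take -map_drop -map_comp.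
rewrite (eq_map (g := ksign e \o ksign (\sum_(f' <- fs) fdeg f'))); last first.
  by move=> x /=; rewrite !ksignD addrC.
rewrite map_comp (hf 0%N) //=; last by rewrite size_map size_takel // hs leq_addr.
rewrite (seq_multilinearZ phiM (s1 := [::])) ?size_tens_entries //=.
rewrite (IHfs _ _ (seq_multilinear_cons _ phiM)); last 2 first.
- by rewrite size_drop hs addKn.
- by move=> i; apply: (hf i.+1).
rewrite scalerA -exprD big_cons; congr (_ *: _); apply: sign_congr.
by rewrite oddD mulrDr odd_abszD.
Qed.

End Factors.

(** * Desuspension of operations *)

Lemma twist_sign (a c l : nat) :
  odd (a.+1 * l.+1 + (a + c + l) + 'C(a + c + l, 2) + c * l) =
  odd ('C((a + c).+1, 2) + a + 'C(l, 2)).+1.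
Proof.
rewrite binS bin1 bin2D.
move: ('C(a + c, 2)) ('C(l, 2)) => x y.
rewrite !(oddD, oddM, oddS).
by case: (odd a) (odd c) (odd l) (odd x) (odd y) => [] [] [] [] [].
Qed.

Section Twist.
Context {R : comPzRingType} {V : grmod R}.
Implicit Types (s t : seq V).

(* [tw [:: v_1; ...; v_n]] is [:: t^(n-1) v_1; ...; t v_(n-1); v_n], [t] being
   [ksign 1]. *)
Fixpoint tw s : seq V :=
  if s is x :: s' then ksign (size s')%:Z x :: tw s' else [::].

Lemma size_tw s : size (tw s) = size s.
Proof. by elim: s => //= x s ->. Qed.

Lemma twK : involutive tw.
Proof. by elim=> //= x s IHs; rewrite size_tw ksignK IHs. Qed.

(** Every entry of [s] gains [size t] further entries on its right. *)
Lemma tw_cat s t : tw (s ++ t) = map (ksign (size t)%:Z) (tw s) ++ tw t.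
Proof.
elim: s => //= x s ->; rewrite size_cat ksignD; congr (_ :: _).
by apply: ksign_odd; congr (odd (absz _)); rewrite PoszD addrC.
Qed.

Lemma tw_map (f : V -> V) s :
  (forall e x, f (ksign e x) = ksign e (f x)) -> tw (map f s) = map f (tw s).
Proof. by move=> fe; elim: s => //= x s ->; rewrite fe size_map. Qed.

Lemma map_ksignD e d s : map (ksign e) (map (ksign d) s) = map (ksign (e + d)) s.
Proof. by rewrite -map_comp; apply: eq_map => x; apply: ksignD. Qed.

Lemma map_ksign_odd e d s :
  odd `|e|%N = odd `|d|%N -> map (ksign e) s = map (ksign d) s.
Proof. by move=> ed; apply: eq_map => x; apply: ksign_odd. Qed.

Definition twist n (phi : tpow V n -> V) s : V :=
  (-1) ^+ 'C(n, 2) *: phi (pure_seq n (tw s)).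

Definition sgn (x : V) : V := - ksign 1 x.

Lemma sgn_linear : linear sgn.
Proof. by move=> a x y; rewrite /sgn linearP opprD -scalerN. Qed.

HB.instance Definition _ := GRing.isLinear.Build R V V *:%R sgn sgn_linear.

Lemma sgn_ksign e x : sgn (ksign e x) = ksign e (sgn x).
Proof. by rewrite /sgn linearN /= !ksignD addrC. Qed.

Lemma twist_multilinear n (phi : {linear tpow V n -> V}) :
  seq_multilinear n (twist phi).
Proof.
move=> s1 s2 a x y hn; rewrite /twist !tw_cat /= linearP.
rewrite pure_seq_multilinear ?size_map ?size_tw // linearP scalerDr.
by rewrite !scalerA mulrC.
Qed.

Lemma map_sgn_multilinear (U : lmodType R) n (phi : seq V -> U) s1 s2 :
  seq_multilinear n phi -> (size s1 + size s2)%N = n ->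
  phi (map sgn s1 ++ s2) = (-1) ^+ size s1 *: phi (map (ksign 1) s1 ++ s2).
Proof.
elim: s1 n phi => [|x s1 IH] n phi phiM; first by rewrite /= scale1r.
case: n phiM => // n phiM [hn].
rewrite /sgn /= -[- _]scaleN1r (seq_multilinearZ phiM (s1 := [::])) /=; last first.
  by rewrite size_cat !size_map hn.
by rewrite (IH _ _ (seq_multilinear_cons _ phiM) hn) scalerA exprS.
Qed.

Lemma sum_fdeg_id m : \sum_(f <- nseq m (@id_factor R V)) fdeg f = 0.
Proof. by rewrite big_nseq; elim: m => //= m ->; rewrite addr0. Qed.

Lemma sumn_farity_id m : sumn (map (@farity R V) (nseq m id_factor)) = m.
Proof. by elim: m => //= m ->. Qed.

Lemma tens_entries_id_cat m fs s : (m <= size s)%N ->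
  tens_entries (nseq m id_factor ++ fs) s =
  map (ksign (\sum_(f <- fs) fdeg f)) (take m s) ++ tens_entries fs (drop m s).
Proof.
elim: m s => [|m IHm] [|x s] //=.
move=> ms; rewrite take0 /= tpow1_pure_seq drop0 IHm //; congr (ksign _ _ :: _).
by rewrite big_cat /= sum_fdeg_id add0r.
Qed.

Lemma tens_entries_id m s : size s = m -> tens_entries (nseq m id_factor) s = s.
Proof.
move=> sm; rewrite -[nseq m _]cats0 tens_entries_id_cat ?sm // big_nil.
by rewrite -{1}sm take_size cats0 -[RHS]map_id; apply: eq_map => x; rewrite ksign0.
Qed.

(** Desuspending one summand of the statement: its sign and the Koszul signs collapse to a single
    minus. The parity condition covers degree l - 2 in arity l as well as the differential, of
    degree -1 in arity 1. *)
Lemma twist_tensor_at (n k l : nat) (phi : {linear tpow V k -> V})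
    (d : int) (psi : {linear tpow V l -> V}) t1 t2 t3 :
  koszul_factor (Factor d psi) -> odd `|d|%N = odd l ->
  size t2 = l -> (size t1 + (size t3).+1)%N = k -> (k + l)%N = n.+1 ->
  (-1) ^+ ((size t1).+1 * l.+1 + n) *:
    twist (phi \o tensor_at n k (size t1).+1 (Factor d psi)) (t1 ++ t2 ++ t3) =
  - twist phi (map sgn t1 ++ twist psi t2 :: t3).
Proof.
move=> psid dl t2l kE nE.
(* [K] is the term without its numerical sign; both sides are brought to the form sign times [K]. *)
pose K := phi (pure_seq k (map (ksign 1) (map (ksign (size t3).+1%:Z) (tw t1)) ++
  ksign (size t3)%:Z (psi (pure_seq l (tw t2))) :: tw t3)).
have pM := seq_multilinear_comp phi (@pure_seq_multilinear R V k).
have -> : twist phi (map sgn t1 ++ twist psi t2 :: t3) =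
    (-1) ^+ ('C(k, 2) + size t1 + 'C(l, 2)) *: K.
  rewrite {1}/twist tw_cat tw_map; last exact: sgn_ksign.
  have -> : map (ksign (size (twist psi t2 :: t3))%:Z) (map sgn (tw t1)) =
      map sgn (map (ksign (size t3).+1%:Z) (tw t1)).
    by rewrite -!map_comp; apply: eq_map => x; rewrite /= sgn_ksign.
  rewrite (map_sgn_multilinear pM) /=; last by rewrite size_map !size_tw.
  rewrite /twist [ksign _ (_ *: _)]linearZ /= (seq_multilinearZ pM);
    last by rewrite !size_map !size_tw.
  by rewrite size_map size_tw !scalerA -!exprD.
rewrite /twist /= /tensor_at tensor_pure_seq; last 3 first.
- by rewrite size_tw !size_cat t2l; lia.
- by rewrite map_cat sumn_cat /= !sumn_farity_id; lia.
- by rewrite size_cat /= !size_nseq; lia.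
rewrite tens_entries_id_cat /=; last by rewrite size_tw size_cat leq_addr.
rewrite !tw_cat big_cons sum_fdeg_id addr0.
have st1 e : size (map (ksign e) (tw t1)) = size t1 by rewrite size_map size_tw.
have st2 e : size (map (ksign e) (tw t2)) = l by rewrite size_map size_tw.
rewrite take_size_cat // drop_size_cat //= take_size_cat // drop_size_cat //.
rewrite tens_entries_id; last by rewrite size_tw; lia.
rewrite [map (ksign 0) _](eq_map (g := id)) ?map_id; last exact: ksign0.
rewrite (psid (size t3)%:Z) /=; last by rewrite size_tw.
rewrite (seq_multilinearZ pM); last by rewrite !size_map !size_tw.
(* With c the size of [t3], the exponents are d + l + c and 1 + (c + 1), of equal parity because d
   and l are. *)
have -> : map (ksign d) (map (ksign (size (t2 ++ t3))%:Z) (tw t1)) =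
    map (ksign 1) (map (ksign (size t3).+1%:Z) (tw t1)).
  rewrite !map_ksignD; apply: map_ksign_odd.
  by rewrite !odd_abszD dl size_cat t2l /= oddD addbA addbb negbK.
rewrite -/K !scalerA -!exprD -scaleN1r scalerA -exprS; congr (_ *: _).
(* On the left: the sign of the statement, the twist of arity [n], and [ksign (size t3)] moved past
   [psi]. On the right: the twists of [phi] and [psi], the signs of [sgn], and the leading minus. *)
apply: sign_congr; rewrite oddD abszM oddM dl -oddM -oddD.
have -> : k = (size t1 + size t3).+1 by rewrite -kE addnS.
have -> : n = (size t1 + size t3 + l)%N by lia.
exact: twist_sign.
Qed.

End Twist.

(** * The index set B(n) and the exponent [vartheta] *)

Fixpoint shapes (n : nat) : seq (seq nat) :=
  if n is n'.+1 then
    [seq 1%N :: r | r <- shapes n'] ++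
    [seq (head 0%N r).+1 :: behead r | r <- shapes n' & ~~ nilp r]
  else [:: [::]].

(** [shapes] follows the recursion of [comps] step by step, which matches B(n) with the compositions
    of a list of size n in the same order. *)
Lemma shapes_comps (T : Type) (s : seq T) :
  map (map size) (comps s) = shapes (size s).
Proof.
elim: s => //= x s <-; rewrite map_cat -!map_comp; congr (_ ++ _).
rewrite filter_map -!map_comp; elim: (comps s) => //= -[|b c] l IHl //=.
by congr (_ :: _).
Qed.

Lemma mem_shapes n r : (r \in shapes n) = all (leq 1) r && (sumn r == n).
Proof.
elim: n r => [|n IHn] r.
  by rewrite inE; case: r => [|[|a] r] //=; rewrite addSn andbF.
rewrite /= mem_cat; case: r => [|a r].
  by apply/norP; split; apply/mapP => -[].
have -> : (a :: r \in [seq 1%N :: r | r <- shapes n]) =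
    (a == 1%N) && (r \in shapes n).
  apply/mapP/andP => [[r' hr' [-> ->]]|[/eqP-> hr]]; first by [].
  by exists r.
have -> : (a :: r \in [seq (head 0%N r).+1 :: behead r | r <- shapes n & ~~ nilp r]) =
    (0 < a)%N && (a.-1 :: r \in shapes n).
  apply/mapP/andP => [[[|b r']]|[a0 hr]].
  - by rewrite mem_filter.
  - by rewrite mem_filter /= => hr [-> ->].
  by exists (a.-1 :: r); rewrite ?mem_filter //= prednK.
rewrite !IHn /=; case: a => [|[|a]] //=; rewrite ?andbF ?orbF //.
Qed.

Lemma shapes_uniq n : uniq (shapes n).
Proof.
elim: n => //= n IHn; rewrite cat_uniq; apply/and3P; split.
- by rewrite map_inj_uniq // => r r' [].
- apply/hasPn => x /mapP[r]; rewrite mem_filter => /andP[r0 hr] ->.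
  apply/mapP => -[r' _ [r00 r'E]]; move: hr; rewrite mem_shapes.
  by case: r r0 r00 r'E => //= a r _ ->.
rewrite map_inj_in_uniq ?filter_uniq // => r r'; rewrite !mem_filter.
by case: r r' => [|a r] [|a' r'] //= _ _ [-> ->].
Qed.

Lemma big_Bset (U : nmodType) (F : nat -> seq nat -> U) n :
  \sum_(k < n.+1 | (2 <= k)%N) \sum_(r in Bset n k) F k (map val r) =
  \sum_(r <- shapes n | (1 < size r)%N) F (size r) r.
Proof.
transitivity (\sum_(k < n.+1 | (2 <= k)%N) \sum_(r <- shapes n | size r == k) F k r).
  apply: eq_bigr => k _; rewrite -[RHS]big_filter -big_enum.
  pose g (r : k.-tuple 'I_n.+1) : seq nat := map val r.
  rewrite -(big_map g xpredT (F k)); apply: perm_big; apply: uniq_perm.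
  - rewrite map_inj_uniq ?enum_uniq // => r r' rr'; apply/val_inj.
    by apply: (inj_map val_inj); exact: rr'.
  - by rewrite filter_uniq ?shapes_uniq.
  move=> r; rewrite mem_filter mem_shapes; apply/mapP/and3P.
    case=> t; rewrite mem_enum inE => /andP[/forallP t0 /eqP tn] ->.
    rewrite size_map size_tuple eqxx; split=> //.
      by apply/allP => _ /mapP[a /tnthP[j ->] ->]; apply: t0.
    by rewrite sumnE big_map big_tuple tn.
  case=> /eqP rk r0 /eqP rn.
  (* An entry is at most the sum [n], so [inord] leaves it unchanged. *)
  have rle a : a \in r -> (a < n.+1)%N.
    move=> ar; rewrite ltnS -rn sumnE (big_rem a) //=; exact: leq_addr.
  have rE : map val (map (@inord n) r) = r.
    rewrite -map_comp -[RHS]map_id; apply/eq_in_map => a /rle ar /=.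
    by rewrite inordK.
  have sr : size (map (@inord n) r) == k by rewrite size_map rk.
  exists (Tuple sr); last by rewrite /g /= rE.
  rewrite mem_enum inE; apply/andP; split.
    apply/forallP => j; apply: (allP r0).
    have := map_f val (mem_tnth j (Tuple sr)); by rewrite rE.
  rewrite -(big_tuple _ _ (Tuple sr) xpredT val) -(big_map val xpredT id) /= rE.
  by rewrite -sumnE rn.
rewrite (exchange_big_dep (fun r => (1 < size r)%N)) /=; last first.
  by move=> k r k2 /eqP ->.
rewrite big_seq_cond [RHS]big_seq_cond; apply: eq_bigr => r /andP[hr r2].
(* Positive entries with sum [n] number at most [n], so [size r] lies in the range of [k]. *)
have rn : (size r < n.+1)%N.
  move: hr; rewrite mem_shapes ltnS => /andP[r0 /eqP <-].
  by elim: r r0 {r2} => //= a r IHr /andP[a0 /IHr]; lia.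
rewrite (big_pred1 (Ordinal rn)) // => k /=.
by rewrite -val_eqE /= eq_sym; case: eqP => [->|_]; rewrite ?r2 ?andbF.
Qed.

(** The first entry multiplies the u_j + 1 of all later entries, whose sum is
    [sumn r' + size r']. *)
Fixpoint seq_vartheta (r : seq nat) : nat :=
  if r is a :: r' then (a * (sumn r' + size r') + seq_vartheta r')%N else 0%N.

Lemma varthetaE k (r : k.-tuple nat) : vartheta (tnth r) = seq_vartheta r.
Proof.
rewrite /vartheta; elim: k r => [|k IHk] r.
  by rewrite big_ord0 tuple0.
case/tupleP: r => a r; rewrite big_ord_recl /= -IHk; congr (_ + _)%N.
  rewrite big_mkcond big_ord_recl /= add0n -big_distrr /= tnth0; congr (_ * _)%N.
  under eq_bigr => j _ do rewrite tnthS -addn1.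
  by rewrite big_split /= sum1_card card_ord size_tuple sumnE big_tuple.
apply: eq_bigr => i _; rewrite big_mkcond big_ord_recl /= add0n [RHS]big_mkcond.
by apply: eq_bigr => j _; rewrite !tnthS.
Qed.

(** * The maps p after desuspension *)

Section HomotopyKernels.
Context {R : comPzRingType} {V : grmod R}.
Variables (mu p : forall n : nat, {linear tpow V n -> V}) (h : {linear V -> V}).
Hypothesis h_deg : hom_degree 1 h.
Hypothesis mu_deg : forall n, (2 <= n)%N -> thom_degree (n%:Z - 2) (mu n).
Hypothesis p_rec : forall n : nat, (2 <= n)%N -> forall x : tpow V n,
  p n x =
  \sum_(k < n.+1 | (2 <= k)%N) \sum_(r in Bset n k)
    (-1) ^+ vartheta (fun j : 'I_k => tnth r j : nat)
    *: mu k (tensor n k [seq hp_factor h p (r_j : 'I_n.+1) | r_j <- r] x).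

Lemma p_shapes n (x : tpow V n) : (2 <= n)%N ->
  p n x = \sum_(r <- shapes n | (1 < size r)%N)
    (-1) ^+ seq_vartheta r *: mu (size r) (tensor n (size r) (map (hp_factor h p) r) x).
Proof.
move=> n2; rewrite p_rec // -(big_Bset (fun k r => (-1) ^+ seq_vartheta r *:
  mu k (tensor n k (map (hp_factor h p) r) x))).
apply: eq_bigr => k _; apply: eq_bigr => r _; rewrite -map_comp; congr (_ ^+ _ *: _).
rewrite -(varthetaE (map_tuple val r)) /vartheta; apply: eq_bigr => i _.
by apply: eq_bigr => j _; rewrite !tnth_map.
Qed.

Lemma farity_hp r : farity (hp_factor h p r) = r.
Proof. by rewrite /hp_factor; case: eqP. Qed.

Lemma fdeg_hp r : fdeg (hp_factor h p r) = r%:Z - 1.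
Proof. by rewrite /hp_factor; case: eqP => // ->. Qed.

Lemma sum_fdeg_hp (r : seq nat) :
  \sum_(f <- map (hp_factor h p) r) fdeg f = (sumn r)%:Z - (size r)%:Z.
Proof.
elim: r => [|a r IHr] /=; first by rewrite big_nil.
by rewrite big_cons fdeg_hp IHr; lia.
Qed.

Lemma sumn_farity_hp (r : seq nat) :
  sumn (map (@farity R V) (map (hp_factor h p) r)) = sumn r.
Proof. by elim: r => //= a r ->; rewrite farity_hp. Qed.

Lemma hp_koszul_factor r : (0 < r)%N ->
  ((2 <= r)%N -> koszul_factor (Factor (r%:Z - 2) (p r))) -> koszul_factor (hp_factor h p r).
Proof.
move=> r0 pr; rewrite /hp_factor; case: eqP => r1; first exact: id_koszul_factor.
have -> : r%:Z - 1 = r%:Z - 2 + 1 by lia.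
by apply: koszul_factor_comp => //; apply: pr; lia.
Qed.

(** Derived from the recursion by strong induction: the factors have total degree n - k and [mu k]
    has degree k - 2, which add up to n - 2. *)
Lemma p_koszul_factor n : (2 <= n)%N -> koszul_factor (Factor (n%:Z - 2) (p n)).
Proof.
have [m] := ubnP n; elim: m n => // m IHm n nm n2 e s /= sn.
rewrite !p_shapes // linear_sum scaler_sumr; rewrite big_seq_cond [RHS]big_seq_cond.
apply: eq_bigr => r /andP[]; rewrite mem_shapes => /andP[r0 /eqP rn] r2.
(* At least two positive parts sum to [n], so each of them is smaller than [n]. *)
have rlt a : a \in r -> (a < n)%N.
  move=> ar; move: r2; rewrite -rn (perm_size (perm_to_rem ar)) /=.
  rewrite (perm_sumn (perm_to_rem ar)) /=.
  have : all (leq 1) (rem a r) by apply/allP => b /mem_rem; apply: (allP r0).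
  by case: (rem a r) => //= b r' /andP[b0 _] _; lia.
have fr i : (i < size (map (hp_factor h p) r))%N ->
    koszul_factor (nth id_factor (map (hp_factor h p) r) i).
  rewrite size_map => ir; rewrite (nth_map 0%N) //.
  have ar := mem_nth 0%N ir; apply: hp_koszul_factor => [|a2]; first exact: (allP r0).
  apply: IHm => //; exact: leq_trans (rlt _ ar) nm.
rewrite linearZ /= !scalerA mulrC -scalerA; congr (_ *: _).
rewrite !tensor_pure_seq ?size_map ?sumn_farity_hp //.
have mM := seq_multilinear_comp (mu (size r)) (@pure_seq_multilinear R V (size r)).
rewrite (tens_entries_ksign (phi := fun s => mu (size r) (pure_seq (size r) s))) //.
- rewrite (thom_degree_koszul_factor (mu_deg r2)) ?size_tens_entries ?size_map //=.
  rewrite scalerA -exprD; congr (_ *: _); apply: sign_congr.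
  rewrite oddD -odd_abszD -mulrDr sum_fdeg_hp rn; congr (odd (absz (_ * _))).
  by lia.
- by rewrite ?size_map ?sumn_farity_hp.
by rewrite ?size_map ?sumn_farity_hp ?rn.
Qed.

Definition twisted (phi : forall n : nat, {linear tpow V n -> V}) (s : seq V) : V :=
  twist (phi (size s)) s.

Local Notation q := (kernel_of h (twisted p)).

Lemma hp_twist s : ~~ nilp s ->
  fmap (hp_factor h p (size s)) (pure_seq (farity (hp_factor h p (size s))) (tw s)) =
  (-1) ^+ 'C(size s, 2) *: q s.
Proof.
case: s => [|x [|y s]] //= _; first by rewrite tpow1_pure_seq ksign0 scale1r.
by rewrite /twisted /twist linearZ /= scalerA -exprD -signr_odd oddD addbb scale1r.
Qed.

(** Each block contributes the sign of its own twist and the sign of moving [ksign (size c')] past a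
    map of degree [size a - 1]. *)
Fixpoint entries_sign (c : seq (seq V)) : nat :=
  if c is a :: c' then
    ('C(size a, 2) + (size a).+1 * size c' + entries_sign c')%N
  else 0%N.

Lemma tens_entries_hp (U : lmodType R) (phi : seq V -> U) c :
  seq_multilinear (size c) phi -> all (predC (@nilp V)) c ->
  phi (tens_entries (map (hp_factor h p) (map size c)) (tw (flatten c))) =
  (-1) ^+ entries_sign c *: phi (tw (map q c)).
Proof.
elim: c phi => [|a c IHc] phi phiM /=; first by rewrite scale1r.
case/andP=> a0 c0.
have fp : koszul_factor (hp_factor h p (size a)).
  by apply: hp_koszul_factor => [|/p_koszul_factor //]; rewrite lt0n.
have := hp_twist a0; have := farity_hp (size a); have := fdeg_hp (size a).
move: (hp_factor h p (size a)) fp => f fp fd fa fq.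
have sa e : size (map (ksign e) (tw a)) = farity f by rewrite size_map size_tw.
rewrite tw_cat take_size_cat // drop_size_cat // map_ksignD sum_fdeg_hp.
(* The later factors have total degree [size (flatten c)] minus the number of blocks; together with
   the shift from [tw_cat] only the number of blocks survives modulo 2. *)
rewrite (map_ksign_odd (d := (size c)%:Z)); last first.
  by rewrite size_flatten /shape size_map; move: (sumn _) (size c) => x y; lia.
rewrite fp ?size_tw // fq linearZ scalerA -exprD size_map.
rewrite (seq_multilinearZ phiM (s1 := [::])) /=; last first.
  by rewrite size_tens_entries !size_map.
rewrite (IHc _ (seq_multilinear_cons _ phiM)) // scalerA -exprD.
congr (_ *: _); apply: sign_congr; rewrite fd abszM /= !(oddD, oddM) /=.
have -> : odd `|(size a)%:Z - 1|%N = ~~ odd (size a) by lia.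
by case: (odd 'C(_, _)) (odd (size c)) (odd (size a)) => [] [] [].
Qed.

(** [vartheta] is exactly the exponent that reconciles the twist of p, the signs of the entries and
    the twist of [mu]; hence the recursion [twisted_rec] has no signs. *)
Lemma hp_sign (c : seq (seq V)) :
  odd ('C(size (flatten c), 2) + seq_vartheta (map size c) + entries_sign c) =
  odd 'C(size c, 2).
Proof.
elim: c => //= a c; rewrite size_cat bin2D binS bin1 -size_flatten size_map.
move: 'C(size (flatten c), 2) (seq_vartheta _) (entries_sign c) 'C(size a, 2) => b1 v e b2.
rewrite !(oddD, oddM, oddS) => <-.
by case: (odd b1) (odd v) (odd e) (odd b2) (odd (size a)) (odd (size c))
  (odd (size (flatten c))) => [] [] [] [] [] [] [].
Qed.

Lemma twisted_rec s : (1 < size s)%N ->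
  twisted p s = \sum_(c <- comps s | (1 < size c)%N) twisted mu (map q c).
Proof.
move=> s1; rewrite {1}/twisted /twist p_shapes // -shapes_comps big_map.
rewrite scaler_sumr big_mkcond [RHS]big_mkcond; apply: eq_big_comps => c cs c0.
rewrite size_map; case: ifP => // c1.
rewrite tensor_pure_seq ?size_map ?sumn_farity_hp ?size_tw // -?cs ?size_flatten //.
rewrite -size_flatten.
have mM := seq_multilinear_comp (mu (size c)) (@pure_seq_multilinear R V (size c)).
rewrite (tens_entries_hp mM) // /twisted /twist size_map !scalerA -!exprD.
by congr (_ *: _); apply: sign_congr; rewrite hp_sign.
Qed.

End HomotopyKernels.

(** * The index set A(n) as cuttings in three pieces *)

Section IndexSums.
Context {U : nmodType} {T : Type}.
Implicit Type s : seq T.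

Lemma big_cuts_size (F : nat -> nat -> U) s :
  \sum_(u <- cuts s) F (size u.1) (size u.2) =
  \sum_(a < (size s).+1) F a (size s - a)%N.
Proof.
elim: s F => [|x s IHs] F; first by rewrite big_seq1 big_ord1.
by rewrite big_cuts_cons big_ord_recl /= (IHs (fun a => F a.+1)).
Qed.

Lemma big_cut3_size (F : nat -> nat -> nat -> U) s :
  \sum_(t <- cut3 s) F (size t.1.1) (size t.1.2) (size t.2) =
  \sum_(a < (size s).+1) \sum_(l < (size s - a).+1) F a l (size s - a - l)%N.
Proof.
rewrite big_cut3 -(big_cuts_size (fun a b => \sum_(l < b.+1) F a l (b - l)%N)).
by apply: eq_bigr => u _; rewrite (big_cuts_size (F (size u.1))).
Qed.

(** The triple (k, l, i) is the cutting with a middle piece of size l after i - 1 entries. Then k =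
    n + 1 - l, and k >= 2 becomes l < n. *)
Lemma big_Aset (F : nat -> nat -> nat -> U) s :
  \sum_(t in Aset (size s)) (let: (k, l, i) := t in F k l i) =
  \sum_(t <- cut3 s | (1 < size t.1.2 < size s)%N)
    F ((size s).+1 - size t.1.2)%N (size t.1.2) (size t.1.1).+1.
Proof.
set n := size s.
rewrite [RHS]big_mkcond (big_cut3_size (fun a l _ =>
  if (1 < l < n)%N then F (n.+1 - l)%N l a.+1 else 0)) -/n.
transitivity (\sum_(a < n.+1) \sum_(l < n.+1 | (1 < l < n)%N && (l <= n - a)%N)
    F (n.+1 - l)%N l a.+1); last first.
  apply: eq_bigr => a _; rewrite -big_mkcond /=.
  have an : ((n - a).+1 <= n.+1)%N by rewrite ltnS leq_subr.
  rewrite (big_ord_widen_cond _ (fun l => 1 < l < n)%N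
    (fun l => F (n.+1 - l)%N l a.+1) an).
  by apply: eq_bigl => l; rewrite ltnS.
rewrite pair_big_dep /=.
rewrite (reindex_onto
  (fun al : 'I_n.+1 * 'I_n.+1 => (inord (n.+1 - al.2), al.2, inord al.1.+1))
  (fun t : 'I_n.+1 * 'I_n.+1 * 'I_n.+1 => (inord t.2.-1, t.1.2))) /=; last first.
  move=> [[k l] i]; rewrite inE => /and5P[/eqP kl k2 l2 i1 ik] /=.
  congr (_, _, _); apply: val_inj; rewrite /= ?inordK; try lia.
have P (a l : 'I_n.+1) : (1 < l < n)%N && (l <= n - a)%N ->
    ((inord (n.+1 - l) : 'I_n.+1) = (n.+1 - l)%N :> nat) *
    ((inord a.+1 : 'I_n.+1) = a.+1 :> nat).
  by move=> al; split; apply/inordK; lia.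
have Q (a l : 'I_n.+1) :
    (((inord (n.+1 - l), l, inord a.+1) : 'I_n.+1 * 'I_n.+1 * 'I_n.+1) \in Aset n) &&
    ((inord (inord a.+1 : 'I_n.+1).-1, l) == (a, l)) =
    (1 < l < n)%N && (l <= n - a)%N.
  rewrite inE xpair_eqE eqxx andbT; apply/idP/idP => [|al]; last first.
    by rewrite !(P _ _ al) -val_eqE /= inordK; lia.
  (* Out of range, [inord] yields 0, which 2 <= k and 1 <= i exclude. *)
  move=> /andP[/and5P[/eqP kl k2 l2 i1 ik] _]; move: kl k2 i1 ik.
  by rewrite /inord !val_insubd /=; case: ifP; case: ifP; lia.
apply: eq_big => [[a l]|[a l] /=]; first exact: Q.
by rewrite Q => al; rewrite !(P _ _ al).
Qed.

Lemma big_nat_cut3 (F : nat -> U) s :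
  \sum_(1 <= u < (size s).+1) F u =
  \sum_(t <- cut3 s | size t.1.2 == 1%N) F (size t.1.1).+1.
Proof.
rewrite [RHS]big_mkcond (big_cut3_size (fun a l _ => if l == 1%N then F a.+1 else 0)).
(* If all entries precede the middle piece, it is empty, so the last index drops out. *)
rewrite big_ord_recr /= subnn big_ord1 /= addr0 big_add1 /= big_mkord.
apply: eq_bigr => a _; have an : (1 < (size s - a).+1)%N by rewrite ltnS subn_gt0.
rewrite (bigD1 (Ordinal an)) //= big1 ?addr0 // => l.
by rewrite -val_eqE /= => /negbTE ->.
Qed.

End IndexSums.

(** * Desuspension of the relations *)

Section TwistedRelation.
Context {R : comPzRingType} {V : complex R}.
Implicit Type s : seq V.

Lemma diff_koszul_factor : koszul_factor (@diff_factor R V).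
Proof. exact: (koszul_factor_comp (@diff_degree R V) id_koszul_factor). Qed.

Lemma twistedE (phi : forall n : nat, {linear tpow V n -> V}) k s :
  size s = k -> twisted phi s = twist (phi k) s.
Proof. by move=> <-. Qed.

(** Common form of both relations: its vanishing is the A-infinity relation for [phi = psi = mu],
    and the claim for [phi = p] with gf p as [psi]. *)
Definition defect (phi psi : forall n : nat, {linear tpow V n -> V}) n
    (x : tpow V n) : V :=
  diff (phi n x)
  - \sum_(1 <= u < n.+1) (-1) ^+ n *: phi n (tensor_at n n u diff_factor x)
  - \sum_(t in Aset n)
      (let: (k, l, i) := t in
      (-1) ^+ (i * l.+1 + n)
      *: phi k (tensor_at n k i (Factor (l%:Z - 2) (psi l)) x)).

Lemma defect_linear phi psi n : linear (@defect phi psi n).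
Proof.
move=> a x y; have signP k (F : {linear tpow V n -> V}) :
    (-1) ^+ k *: F (a *: x + y) = a *: ((-1) ^+ k *: F x) + (-1) ^+ k *: F y.
  by rewrite linearP scalerDr !scalerA mulrC.
rewrite /defect !scalerBr !scaler_sumr !linearP /=.
under eq_bigr => u _ do rewrite (signP n (phi n \o tensor_at n n u diff_factor)).
under [X in _ - _ - X]eq_bigr => t _.
  have -> : (let: (k, l, i) := t in (-1) ^+ (i * l.+1 + n)
      *: phi k (tensor_at n k i (Factor (l%:Z - 2) (psi l)) (a *: x + y))) =
    a *: (let: (k, l, i) := t in (-1) ^+ (i * l.+1 + n)
      *: phi k (tensor_at n k i (Factor (l%:Z - 2) (psi l)) x)) +
    (let: (k, l, i) := t in (-1) ^+ (i * l.+1 + n)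
      *: phi k (tensor_at n k i (Factor (l%:Z - 2) (psi l)) y)).
    case: t => [[k l] i].
    exact: (signP _ (phi k \o tensor_at n k i (Factor (l%:Z - 2) (psi l)))).
  over.
by rewrite !big_split /= !opprD (addrACA (a *: _)) [LHS]addrACA.
Qed.

HB.instance Definition _ phi psi n :=
  GRing.isLinear.Build R (tpow V n) V *:%R (@defect phi psi n)
    (@defect_linear phi psi n).

(** By [twist_tensor_at] every summand loses its sign. Middle pieces of size 1 come from the sum
    with the differential, longer ones from A(n). *)
Lemma twisted_relation (phi psi : forall n : nat, {linear tpow V n -> V}) s :
  (forall l : nat, (2 <= l)%N -> koszul_factor (Factor (l%:Z - 2) (psi l))) ->
  (1 < size s)%N ->
  (-1) ^+ 'C(size s, 2) *: defect phi psi (pure_seq (size s) (tw s)) =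
  diff (twisted phi s) + \sum_(t <- cut3 s | inner t)
    twisted phi (map sgn t.1.1 ++
      (if t.1.2 is [:: v] then diff v else twisted psi t.1.2) :: t.2).
Proof.
move=> psi_par s1; set n := size s; set x := pure_seq n _; rewrite /defect.
rewrite (big_Aset (fun k l i => (-1) ^+ (i * l.+1 + n)
  *: phi k (tensor_at n k i (Factor (l%:Z - 2) (psi l)) x))).
rewrite (big_nat_cut3 (fun u => (-1) ^+ n *: phi n (tensor_at n n u diff_factor x))).
have -> : diff (twisted phi s) = (-1) ^+ 'C(n, 2) *: diff (phi n x).
  by rewrite /twisted /twist linearZ.
rewrite !scalerBr -!addrA; congr (_ + _).
rewrite [RHS](bigID (fun t => size t.1.2 == 1%N)) /= !scaler_sumr -!sumrN.
have size_cut (t : seq V * seq V * seq V) : t.1.1 ++ t.1.2 ++ t.2 = s ->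
    (size t.1.1 + (size t.1.2 + size t.2))%N = n.
  by move=> ts; rewrite /n -ts !size_cat.
congr (_ + _); rewrite big_mkcond [RHS]big_mkcond; apply: eq_big_cut3 => t ts.
  have st := size_cut t ts.
  have -> : inner t && (size t.1.2 == 1%N) = (size t.1.2 == 1%N).
    rewrite andbC andb_idr // /inner /nilp => /eqP t1; rewrite t1 /=.
    by rewrite -addn_eq0; lia.
  case: ifP => // /eqP t1; case: t t1 ts st => [[t1 [|v [|]]] t3] //= _ ts st.
  have {ts}-> : x = pure_seq n (tw (t1 ++ [:: v] ++ t3)) by rewrite /x -ts.
  (* The differential becomes a twisted operation of arity 1, so [twist_tensor_at] applies with l =
     1, where its exponent has the parity of [n]. *)
  have <- : twist (diff \o tpow1) [:: v] = diff v.
    by rewrite /twist /= tpow1_pure_seq ksign0 scale1r.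
  rewrite (twistedE phi (k := n)); last by rewrite size_cat /= size_map; lia.
  rewrite -[RHS]opprK -(twist_tensor_at (n := n) _ diff_koszul_factor) //; try lia.
  rewrite /twist /= !scalerA mulrC; congr (- (_ * _ *: _)); apply: sign_congr.
  by rewrite oddD oddM andbF.
have st := size_cut t ts.
have -> : inner t && (size t.1.2 != 1%N) = (1 < size t.1.2 < n)%N.
  rewrite /inner /nilp; lia.
case: ifP => // /andP[t1 tn].
have {ts}-> : x = pure_seq n (tw (t.1.1 ++ t.1.2 ++ t.2)) by rewrite /x -ts.
case: t st t1 tn => [[t1 t2] t3] /= st t2_gt1 t2_lt.
have -> : (if t2 is [:: v] then diff v else twisted psi t2) = twisted psi t2.
  by case: t2 t2_gt1 {st t2_lt} => [|? []].
rewrite (twistedE phi (k := (n.+1 - size t2)%N)); last first.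
  by rewrite size_cat /= size_map; lia.
rewrite -[RHS]opprK -(twist_tensor_at (n := n) _ (psi_par _ t2_gt1)) //; try lia.
by rewrite /twist /= !scalerA mulrC.
Qed.

End TwistedRelation.

(** * Transfer for the desuspended maps *)

Section TwistedTransfer.
Context {R : comPzRingType} {V : complex R}.
Variables (mu p : forall n : nat, {linear tpow V n -> V}).
Variables (h G : {linear V -> V}).
Implicit Type s : seq V.

Definition twisted_mu s : V := if s is [:: v] then diff v else twisted mu s.

Lemma twisted_mu_gt1 s : (1 < size s)%N -> twisted_mu s = twisted mu s.
Proof. by case: s => [|? []]. Qed.

Lemma twisted_muD s1 x y s2 :
  twisted_mu (s1 ++ (x + y) :: s2) =
  twisted_mu (s1 ++ x :: s2) + twisted_mu (s1 ++ y :: s2).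
Proof.
have [s12|s12] := posnP (size s1 + size s2)%N.
  have [-> ->] : s1 = [::] /\ s2 = [::] by case: s1 s2 s12 => [|? ?] [].
  exact: linearD.
have sz z : size (s1 ++ z :: s2) = (size s1 + size s2).+1.
  by rewrite size_cat /= addnS.
rewrite !twisted_mu_gt1 ?sz // !(twistedE _ (sz _)).
have := twist_multilinear (mu (size s1 + size s2).+1).
by move=> /(_ s1 s2 1 x y); rewrite !scale1r addnS; apply.
Qed.

Hypothesis mu_ainf : Ainfinity mu.
Hypothesis h_deg : hom_degree 1 h.
Hypothesis homotopy : forall x, G x = x + diff (h x) + h (diff x).
Hypothesis p_rec : forall n : nat, (2 <= n)%N -> forall x : tpow V n,
  p n x =
  \sum_(k < n.+1 | (2 <= k)%N) \sum_(r in Bset n k)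
    (-1) ^+ vartheta (fun j : 'I_k => tnth r j : nat)
    *: mu k (tensor n k [seq hp_factor h p (r_j : 'I_n.+1) | r_j <- r] x).

Let mu_deg := proj1 mu_ainf.
Let p_par := p_koszul_factor h_deg mu_deg p_rec.

(** For n >= 2 entries, the n minus signs and the passage of [ksign 1] past p, of degree n - 2, and
    past [h], of degree 1, give the odd exponent n + (n - 2) + 1. This is the minus sign in
    [sgn]. *)
Lemma kernel_of_sgn s : ~~ nilp s ->
  kernel_of h (twisted p) (map sgn s) = sgn (kernel_of h (twisted p) s).
Proof.
case: s => [|v [|w s]] // _; set t := _ :: _.
have t2 : (1 < size t)%N by [].
rewrite !kernel_of_gt1 ?size_map // (twistedE _ (size_map sgn t)).
have := map_sgn_multilinear (s2 := [::]) (twist_multilinear (p (size t)))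
  (addn0 (size t)).
rewrite !cats0 => ->.
rewrite /twisted /twist tw_map; last by move=> e x; rewrite !ksignD addrC.
rewrite (p_par t2) ?size_tw //= /sgn !linearZ /= -[- ksign _ _]scaleN1r.
rewrite (hom_degree_ksign _ _ h_deg) !scalerA -!exprD -exprSr; congr (_ *: _).
apply: sign_congr.
move: 'C(_, _) => b; rewrite ?mul1r; lia.
Qed.

Lemma twisted_mu_ainf s : (1 < size s)%N ->
  \sum_(t <- cut3 s | ~~ nilp t.1.2)
    twisted_mu (map sgn t.1.1 ++ twisted_mu t.1.2 :: t.2) = 0.
Proof.
move=> s1; have [_ /(_ _ s1 (pure_seq (size s) (tw s)))] := mu_ainf.
move/eqP; rewrite -subr_eq0 => /eqP rel.
have mu_par l : (2 <= l)%N -> koszul_factor (Factor (l%:Z - 2) (mu l)).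
  by move=> l2; apply/thom_degree_koszul_factor/mu_deg.
have := twisted_relation mu mu_par s1; rewrite /defect rel scaler0 => {rel} E.
rewrite [RHS]E {E}.
rewrite big_cut3_full /=; last by case: s s1.
rewrite (twisted_mu_gt1 s1); congr (_ + _); rewrite big_mkcond [RHS]big_mkcond.
apply: eq_bigr => t _; case: ifP => // ti; rewrite twisted_mu_gt1 //.
rewrite size_cat size_map /=; move: ti; rewrite /inner /nilp; lia.
Qed.

Lemma twisted_transfer s : (1 < size s)%N ->
  diff (twisted p s) + \sum_(t <- cut3 s | inner t)
    twisted p (map sgn t.1.1 ++
      (if t.1.2 is [:: v] then diff v else twisted (fun l => G \o p l) t.1.2)
      :: t.2) = 0.
Proof.
move=> s1.
rewrite -[RHS](@transfer_shifted V sgn diff h G twisted_mu (twisted p) _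
  twisted_muD twisted_mu_ainf homotopy _ kernel_of_sgn s s1) //.
  congr (_ + _); apply: eq_bigr => t _; congr (twisted p (_ ++ _ :: _)).
  case: t.1.2 => [|v [|w s']] //=; rewrite /twisted /twist /= linearZ //.
move=> {s1}s s1; rewrite (twisted_rec h_deg mu_deg p_rec s1).
apply: eq_bigr => c c1; rewrite twisted_mu_gt1 // size_map //.
Qed.

End TwistedTransfer.

(** * Return to the original signs *)

Unset Implicit Arguments.

Theorem theorem3p6 (R : comPzRingType) (V W : complex R)
    (mu : forall n : nat, {linear tpow V n -> V})
    (f : {linear V -> W}) (g : {linear W -> V}) (h : {linear V -> V})
    (p : forall n : nat, {linear tpow V n -> V}) :
  Ainfinity mu ->
  chain_map f -> chain_map g ->
  hom_degree 1 h ->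
  (forall x : V, g (f x) - x = diff (h x) + h (diff x)) ->
  (forall n : nat, (2 <= n)%N -> forall x : tpow V n,
    p n x =
    \sum_(k < n.+1 | (2 <= k)%N) \sum_(r in Bset n k)
      (-1) ^+ vartheta (fun j : 'I_k => tnth r j : nat)
      *: mu k (tensor n k [seq hp_factor h p (r_j : 'I_n.+1) | r_j <- r] x)) ->
  forall n : nat, (2 <= n)%N -> forall x : tpow V n,
    diff (p n x)
    - \sum_(1 <= u < n.+1) (-1) ^+ n *: p n (tensor_at n n u diff_factor x)
    - \sum_(t in Aset n)
        (let: (k, l, i) := t in
        (-1) ^+ (i * l.+1 + n)
        *: p k (tensor_at n k i (Factor (l%:Z - 2) (g \o f \o p l)) x))
    = 0.
Proof.
move=> mu_ainf [f_deg _] [g_deg _] h_deg homotopy p_rec n n2 x.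
have G_deg : hom_degree 0 (g \o f).
  by move=> i y yi /=; rewrite -[0]addr0 addrA; apply/g_deg/f_deg.
have gfE y : (g \o f) y = y + diff (h y) + h (diff y).
  by rewrite /= -addrA -homotopy addrC subrK.
(* [defect] is linear, so pure tensors suffice. *)
apply: (tpow_linear_ext (f := @defect _ _ p (fun l => g \o f \o p l) n)
  (g := \0 : {linear tpow V n -> V})) => v.
(* As [tw] is an involution, every pure tensor comes from a twisted list, the form that
   [twisted_relation] treats. *)
have -> : pure v = pure_seq n (tw (tw v)).
  rewrite twK /pure_seq; congr pure; apply: val_inj.
  by rewrite /= mktuple_seq // size_tuple.
have sn : size (tw v) = n by rewrite size_tw size_tuple.
move: (tw v) sn => s sn; move: n2 {x v}; rewrite -sn => s1 {n sn}.
have gfp_par l : (2 <= l)%N -> koszul_factor (Factor (l%:Z - 2) (g \o f \o p l)).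
  move=> l2; rewrite -[_ - 2]addr0; apply: (koszul_factor_comp G_deg).
  exact: (p_koszul_factor h_deg (proj1 mu_ainf) p_rec l2).
have := twisted_relation p gfp_par s1.
rewrite (twisted_transfer mu_ainf h_deg (G := g \o f) gfE p_rec s1).
(* Multiplying by the sign of the twist once more removes it. *)
move/(congr1 ( *:%R ((-1) ^+ 'C(size s, 2)))).
by rewrite scaler0 scalerA -exprD -signr_odd oddD addbb scale1r.
Qed.
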